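(* Let $\Gamma$ be a compact metric graph with $g(\Gamma) \geq 2$. Let $\phi \colon \Gamma'\rightarrow\Gamma$ be the universal covering map. Let $\mu_{\phi, \mathrm{can}}$ be the pushdown of the canonical measure of $\Gamma'$, and let $G$ be a model for $\Gamma$. Then for every oriented edge $e \in \mathbb{E}(G)$, $$\mu_{\phi, \mathrm{can}}|_e=\frac{1}{\mathscr{S}(e)+\ell(e)} \, dx ,$$ where $\mathscr{S}(e) = R(e)+R(\bar{e})$.
   Context: Metric graphs. A metric graph is a connected metric space $\Gamma$ such that, for some fixed $\epsilon>0$, every point has a neighborhood isometric to a star-shaped set $S(n,r)=\{te^{2\pi i k/n} : 0\le t<r,\ k\in\mathbb{Z}\}\subset\mathbb{C}$ of finite valence $n$ and radius $r\geq\epsilon$, endowed with the path metric. $\Gamma$ need not be compact. A vertex set is a discrete subset $V\subset\Gamma$ containing all points of valence $\neq 2$ such that every connected component of $\Gamma\setminus V$ is isometric (in its path metric) to a bounded open interval. It determines a model $G$: the weighted graph with vertex set $V(G)=V$, edge set $E(G)$ the set of components of $\Gamma\setminus V$, and $\ell(e)>0$ the length of the edge $e$ (loops and multiple edges are allowed). $\mathbb{E}(G)$ is the set of oriented edges; each edge has two orientations $e,\bar e\in\mathbb{E}(G)$; $e^-$ and $e^+$ are the initial and terminal vertices of $e$. An orientation $\mathcal{O}\subset\mathbb{E}(G)$ selects one orientation of each edge. The genus $g(\Gamma)$ is the dimension of the first homology of $\Gamma$. Forms. $C^1(G,\mathbb{R})$ is the space of functions $\omega:\mathbb{E}(G)\to\mathbb{R}$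 with $\omega(\bar e)=-\omega(e)$; put $\omega_e=\omega(e)/\ell(e)$, and let $de\in C^1(G,\mathbb{R})$ be defined by $(de)(e)=\ell(e)$ and $(de)(e')=0$ for $e'\in\mathcal{O}$, $e'\ne e$. The (partially defined) pairing is $\langle\omega,\omega'\rangle=\sum_{e\in\mathcal{O}}\omega_e\omega'_e\ell(e)$, $\|\omega\|^2=\langle\omega,\omega\rangle$, and $C^1_{L^2}(G,\mathbb{R})=\{\omega : \|\omega\|<\infty\}$ is a Hilbert space. For $\omega\in C^1(G,\mathbb{R})$ put $d^*\omega=\sum_{v\in V(G)}\big(\sum_{e\in\mathcal{O},\,e^+=v}\omega_e-\sum_{e\in\mathcal{O},\,e^-=v}\omega_e\big)\delta_v$, a signed measure ($\delta_v$ the Dirac measure). The space $\mathcal{H}_{L^2}(\Gamma)=\{\omega\in C^1_{L^2}(G,\mathbb{R}) : d^*\omega=0\}$ is closed and does not depend on the model (when an edge is subdivided, the value $\omega_e$ is kept on the pieces). Canonical measure and pushdown. The canonical measure $\mu^{\Gamma}_{\mathrm{can}}$ is the Borel measure on $\Gamma$ which on each edge of a model $G$ is a constant multiple of Lebesgue measure $dx$, with $\mu^\Gamma_{\mathrm{can}}(e)=(\pi(de))_e$, where $\pi$ is the orthogonal projection onto $\mathcal{H}_{L^2}(\Gamma)$. For the universal cover $\phi:\Gamma'\to\Gamma$ (with the metric making $\phi$ locally isometric on sheets), $\mu_{\phi,\mathrm{can}}$ is the measure on $\Gamma$ with constant density on each edge $e$ of $G$ and $\mu_{\phi,\mathrm{can}}(e)=\mu^{\Gamma'}_{\mathrm{can}}(e')$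 for any lift $e'$ of $e$. Transience. A metric graph $T$ is transient if for some (equivalently, every) $x\in T$ there is an $L^2$ form $\omega$ on $T$ (on some model having $x$ as a vertex) with $d^*\omega=\delta_x$. The function $R$. Let $G'$ be the model of $\Gamma'$ with vertex set $\phi^{-1}(V(G))$; it is a tree. For $e\in\mathbb{E}(G)$ and a lift $e'\in\mathbb{E}(G')$ of $e$, let $T(e')$ be the connected component of $\Gamma'$ minus the interior of $e'$ that contains $e'^+$; its isometry type depends only on $e$. Define $R:\mathbb{E}(G)\to\mathbb{R}^{>0}\cup\{+\infty\}$ by $R(e)=+\infty$ if $T(e')$ is not transient, and $R(e)=\inf\|\omega\|^2$ if $T(e')$ is transient, the infimum being over all $L^2$ cochains $\omega$ on $T(e')$ (with the model induced by $G'$) with $d^*\omega=\delta_{e'^+}$. The convention $1/(+\infty)=0$ is used. *)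

(* Defs.v *)
From HB Require Import structures.
From mathcomp Require Import all_boot all_order all_algebra.
From mathcomp Require Import all_classical all_reals all_analysis.

Set Implicit Arguments.
Unset Strict Implicit.
Unset Printing Implicit Defensive.

Import Order.TTheory GRing.Theory Num.Theory.
Import numFieldTopology.Exports numFieldNormedType.Exports.

Local Open Scope classical_set_scope.
Local Open Scope ring_scope.

(* The point is only needed because generated sigma-algebras are defined on
   pointed types; it plays no role beyond asserting that the space is
   nonempty. *)
#[short(type="pmetricType")]
HB.structure Definition PointedMetric (K : numDomainType) :=
  { M of Metric K M & isPointed M }.

Definition borel {R : realType} (X : pmetricType R) :=
  g_sigma_algebraType (@open X).

Section MetricGraph.
Context {R : realType} {X : metricType R}.
Implicit Types (A C V : set X) (x y : X).

(** Metric graphs. A metric graph is given as a subset [A] of an ambient metric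
    space, with the restricted metric, so that one set of definitions covers
    both a whole space [[set: X]] and the subgraphs T(e'). *)

(* The point t exp(2 pi i k / n) of S(n, r) is encoded by its arm k : 'I_n and
   its distance t to the centre; the [if] is the path metric of S(n, r).  The
   centre is adjoined separately so that n = 0 (one-point graph) makes sense. *)
Definition star_nbhd A x (n : nat) (r : R) : Prop :=
  exists f : 'I_n -> R -> X,
    let U := [set x] `|` [set y | exists k t, 0 <= t < r /\ y = f k t] in
    [/\ forall k, f k 0 = x,
        forall k j s t, 0 <= s < r -> 0 <= t < r ->
          mdist (f k s) (f j t) = if k == j then `|s - t| else s + t,
        U `<=` A &
        exists2 W, nbhs x W & W `&` A `<=` U].

Definition metric_graph A : Prop :=
  [/\ A !=set0, connected A &
      exists2 eps, 0 < eps & forall x, A x ->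
        exists n r, eps <= r /\ star_nbhd A x n r].

Definition has_valence A x (n : nat) : Prop :=
  exists2 r, 0 < r & star_nbhd A x n r.

Definition curve_length (c : R -> X) : \bar R :=
  ereal_sup [set (\sum_(p <- zip (0 :: s) s) mdist (c p.1) (c p.2))%:E
            | s in [set s | itv_partition 0 1 s]].

Definition path_dist C x y : \bar R :=
  ereal_inf [set curve_length c | c in [set c : R -> X |
    [/\ {within `[0, 1]%classic, continuous c}, c @` `[0, 1]%classic `<=` C,
        c 0 = x & c 1 = y]]].

(* [g], on ]0, l[, is an isometry onto [C] endowed with its path metric. *)
Definition path_isometry C (l : R) (g : R -> X) : Prop :=
  g @` `]0, l[%classic = C /\
  forall s t, 0 < s < l -> 0 < t < l ->
    path_dist C (g s) (g t) = (`|s - t|)%:E.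

Definition vertex_set A V : Prop :=
  [/\ V `<=` A,
      V `<=` isolated V,
      forall x n, A x -> has_valence A x n -> n <> 2%N -> V x &
      forall x, (A `\` V) x -> exists l g,
        0 < l /\ path_isometry (connected_component (A `\` V) x) l g].

End MetricGraph.

(** Oriented edges. An oriented edge of length l is the isometry of ]0, l[ onto
    a component of the complement of the vertices that runs in the given
    direction; there are two for each component.  It is extended by continuity
    to its endpoints and by constants beyond them, which makes [epar] unique. *)
Record oseg (R : realType) (X : Type) := OSeg { elen : R ; epar : R -> X }.

HB.instance Definition _ (R : realType) (X : Type) := gen_eqMixin (oseg R X).
HB.instance Definition _ (R : realType) (X : Type) :=
  gen_choiceMixin (oseg R X).

Section Model.
Context {R : realType} {X : metricType R}.
Implicit Types (A V : set X) (e : oseg R X) (E O : set (oseg R X)).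
Implicit Types (w : oseg R X -> R).

Definition src e : X := epar e 0.
Definition tgt e : X := epar e (elen e).
Definition bar e : oseg R X :=
  OSeg (elen e) (fun t => epar e (elen e - t)).
Definition seg_int e : set X := epar e @` `]0, elen e[%classic.

Definition oedges A V : set (oseg R X) :=
  [set e | [/\ 0 < elen e, continuous (epar e),
    (forall t, t <= 0 -> epar e t = src e) /\
    (forall t, elen e <= t -> epar e t = tgt e),
    V (src e) /\ V (tgt e) &
    exists2 x, (A `\` V) x &
      path_isometry (connected_component (A `\` V) x) (elen e) (epar e)]].

Definition orientation E O : Prop :=
  O `<=` E /\
  forall e, E e -> (O e /\ ~ O (bar e)) \/ (~ O e /\ O (bar e)).

(** Forms. Only the values of [w] on the oriented edges of the model matter. *)

Definition cochain E w : Prop := forall e, E e -> w (bar e) = - w e.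

Definition rate w e : R := w e / elen e.

(* Positive part minus negative part; on L^2 forms both are finite. *)
Definition pairing O w w' : \bar R :=
  let f e := rate w e * rate w' e * elen e in
  (\esum_(e in O) (Num.max (f e) 0)%:E
   - \esum_(e in O) (Num.max (- f e) 0)%:E)%E.

Definition sqnorm O w : \bar R := pairing O w w.

Definition L2form E O w : Prop := cochain E w /\ (sqnorm O w < +oo)%E.

(* The measure d^*w on the vertices, given by its mass at each vertex [v]. *)
Definition dstar O w (v : X) : R :=
  \sum_(e \in O `&` [set e | tgt e = v]) rate w e
  - \sum_(e \in O `&` [set e | src e = v]) rate w e.

Definition dstar_dirac V O w (x : X) : Prop :=
  forall v, V v -> dstar O w v = (v == x)%:R.

Definition harmonicL2 A V O w : Prop :=
  L2form (oedges A V) O w /\ forall v, V v -> dstar O w v = 0.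

Definition dform e : oseg R X -> R := fun e' =>
  if e' == e then elen e else if e' == bar e then - elen e else 0.

Definition orth_proj A V O w p : Prop :=
  harmonicL2 A V O p /\
  forall w', harmonicL2 A V O w' ->
    pairing O (fun e => w e - p e) w' = 0%E.

(** First homology, with real coefficients, computed by the cellular chain
    complex of a model (which has no 2-cells). *)
Definition cycle1 A V O (c : oseg R X -> R) : Prop :=
  [/\ cochain (oedges A V) c, finite_set (O `&` [set e | c e != 0]) &
      forall v, V v ->
        \sum_(e \in O `&` [set e | tgt e = v]) c e
        - \sum_(e \in O `&` [set e | src e = v]) c e = 0].

Definition has_genus A (g : nat) : Prop :=
  exists V O (b : 'I_g -> oseg R X -> R),
    [/\ vertex_set A V, orientation (oedges A V) O,
        forall i, cycle1 A V O (b i) &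
        forall c, cycle1 A V O c ->
          exists! a : 'rV[R]_g,
            forall e, O e -> c e = \sum_(i < g) a 0 i * b i e].

Definition transient A : Prop :=
  exists x V O w,
    [/\ A x, vertex_set A V /\ V x, orientation (oedges A V) O,
        L2form (oedges A V) O w & dstar_dirac V O w x].

(** The half tree T(e) and its resistance, for an edge of the model with
    vertex set [V]. *)
Definition half_tree e : set X := connected_component (~` seg_int e) (tgt e).

Definition half_resistance V e : \bar R :=
  let T := half_tree e in let VT := V `&` T in
  if `[< transient T >] then
    ereal_inf [set r | exists O w,
      [/\ orientation (oedges T VT) O, L2form (oedges T VT) O w,
          dstar_dirac VT O w (tgt e) & r = sqnorm O w]]
  else +oo%E.

(* The measure dx carried by the edge underlying [e]. *)
Definition edge_dx e (B : set X) : \bar R :=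
  lebesgue_measure (epar e @^-1` B `&` `]0, elen e[%classic).

End Model.

Section Measures.
Context {R : realType} {X : pmetricType R}.
Implicit Types (V : set X) (e : oseg R X).
Implicit Types (mu : {measure set (borel X) -> \bar R}).

(* mu|_e = c dx *)
Definition restr_edge mu e (c : \bar R) : Prop :=
  forall B : set (borel X), measurable B ->
    mu (B `&` seg_int e) = (c * edge_dx e B)%E.

Definition canonical_measure mu : Prop :=
  forall V O, vertex_set [set: X] V -> orientation (oedges [set: X] V) O ->
    (forall v, V v -> mu [set v] = 0%E) /\
    forall e, oedges [set: X] V e ->
      (exists2 c : R, 0 <= c & restr_edge mu e c%:E) /\
      exists p, orth_proj [set: X] V O (dform e) p /\
        mu (seg_int e) = (rate p e)%:E.

End Measures.

Section UniversalCover.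
Context {R : realType} {X' X : metricType R}.
Implicit Types (phi : X' -> X) (e : oseg R X).

Definition evenly_covered phi (U : set X) : Prop :=
  exists F : set (set X'),
    [/\ phi @^-1` U = \bigcup_(S in F) S, trivIset F id &
        forall S, F S -> open S /\
          exists g : X -> X',
            [/\ {within U, continuous g}, forall x, U x -> S (g x),
                forall x, U x -> phi (g x) = x &
                forall y, S y -> g (phi y) = y]].

Definition locally_isometric phi : Prop :=
  forall y : X', exists2 N, nbhs y N &
    forall a b, N a -> N b -> mdist (phi a) (phi b) = mdist a b.

Definition simply_connected (Y : topologicalType) : Prop :=
  [/\ [set: Y] !=set0,
      forall x y : Y, exists c : R -> Y,
        [/\ {within `[0, 1]%classic, continuous c}, c 0 = x & c 1 = y] &
      forall c : R -> Y, {within `[0, 1]%classic, continuous c} ->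
        c 0 = c 1 ->
        exists H : R * R -> Y,
          [/\ {within `[0, 1]%classic `*` `[0, 1]%classic, continuous H},
              forall t, 0 <= t <= 1 -> H (0, t) = c t,
              forall t, 0 <= t <= 1 -> H (1, t) = c 0 &
              forall s, 0 <= s <= 1 -> H (s, 0) = c 0 /\ H (s, 1) = c 0]].

Definition universal_covering phi : Prop :=
  [/\ metric_graph [set: X'] /\ simply_connected X',
      continuous phi,
      forall x, exists y, phi y = x,
      forall x, exists U, [/\ open U, U x & evenly_covered phi U] &
      locally_isometric phi].

(* [e'] is a lift of [e] in the model with vertex set phi^-1(V). *)
Definition lift_of phi (V : set X) e (e' : oseg R X') : Prop :=
  [/\ oedges [set: X'] (phi @^-1` V) e', elen e' = elen e &
      phi \o epar e' = epar e].

(* The function R on oriented edges; the value does not depend on the lift. *)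
Definition is_resistance phi (V : set X) (Res : oseg R X -> \bar R) : Prop :=
  forall e (e' : oseg R X'), oedges [set: X] V e -> lift_of phi V e e' ->
    Res e = half_resistance (phi @^-1` V) e'.

End UniversalCover.

Definition pushdown_measure {R : realType} {X' X : pmetricType R}
    (phi : X' -> X) (V : set X)
    (mu' : {measure set (borel X') -> \bar R})
    (mu : {measure set (borel X) -> \bar R}) : Prop :=
  (forall v, V v -> mu [set v] = 0%E) /\
  forall e, oedges [set: X] V e ->
    (exists2 c : R, 0 <= c & restr_edge mu e c%:E) /\
    forall e', lift_of phi V e e' -> mu (seg_int e) = mu' (seg_int e').

(* Main.v *)
(* Let [e'] be a lift of [e] to the tree [X'], of length [l].  Removing its
   interior leaves two half trees.  They are disjoint: otherwise some loop runs
   once through [e'], and its image under a map from [X'] to a circle that wraps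
   [e'] around once has degree 1, although the loop is null-homotopic.  Hence a
   harmonic form [w] with [w_{e'} = 1] is the same thing as a unit flow [w1] on
   one half tree together with a unit flow [w2] on the other, and
   [|w|^2 = l + |w1|^2 + |w2|^2].  The projection [p] of [de'] represents
   evaluation at [e'], that is [<p, w> = w(e')] for harmonic [w]; so
   [|p|^2 = p_{e'} l] and, by Cauchy-Schwarz, [l <= p_{e'} |w|^2] when
   [w_{e'} = 1], with equality for [w = p / p_{e'}].  Therefore
   [l / p_{e'} = l + R(e') + R(bar e')], and [p_{e'} = 0] when one of the two
   half trees carries no unit flow.  Attainment of the infima comes from [p],
   which is given, so no completeness argument is needed. *)

Require Import Defs.
From mathcomp Require Import all_boot all_order all_algebra.
From mathcomp Require Import all_classical all_reals all_analysis.
From mathcomp Require Import lra ring.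

Set Implicit Arguments.
Unset Strict Implicit.
Unset Printing Implicit Defensive.

Import Order.TTheory GRing.Theory Num.Theory.
Import numFieldTopology.Exports numFieldNormedType.Exports.

Local Open Scope classical_set_scope.
Local Open Scope ring_scope.

(** * Metric spaces and chaining along segments *)

(** Two obstacles shape the proof. First, an edge is an isometry only for the path distance of its
    open component, and [mdist] agrees with the path metric only inside small stars. Edge parameters
    therefore bound [mdist] from one side only; that edges are open, that vertices meet finitely
    many edges and that components are joined by curves has to be extracted from star
    neighbourhoods. The open edges of [X] are closed up by compactness, those of [X'], which may be
    non-compact, are lifted from [X]. Second, energies are extended reals and a pairing is a
    difference of two possibly infinite sums, so Cauchy-Schwarz goes through a nonnegative
    decomposition with a free parameter. The infimum defining a resistance ranges over all
    orientations of the half tree; hence the orientation of the whole tree is glued from those of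
    two given flows, and [p_{e'}] must have the same value for every orientation, which holds
    because it is the mass of an edge. The degree of a loop is computed on a finite grid by rounding
    to integers, so maps to the circle never have to be lifted. *)

Section MetricBasics.
Context {R : realType}.
Implicit Types (X Y : metricType R).

Lemma nbhs_mdistP X (x : X) (W : set X) :
  nbhs x W <-> exists2 r : R, 0 < r & forall y, mdist x y < r -> W y.
Proof.
split=> [/nbhs_ballP[r r0 rW]|[r r0 rW]].
  by exists r => // y xy; apply: rW; rewrite ballEmdist.
by apply/nbhs_ballP; exists r => // y; rewrite ballEmdist => /rW.
Qed.

Lemma within_mdistP X (D : set R) (c : R -> X) :
  {within D, continuous c} <->
  forall t, D t -> forall eps, 0 < eps ->
    exists2 d, 0 < d & forall s, D s -> `|t - s| < d -> mdist (c t) (c s) < eps.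
Proof.
rewrite subspace_continuousP; split=> cc t Dt.
  move=> eps eps0; have /cvg_ballP/(_ eps eps0) := cc t Dt.
  rewrite near_withinE => /nbhs_ballP[d d0 dD]; exists d => // s Ds ts.
  by have := dD s ts Ds; rewrite ballEmdist.
apply/cvg_ballP => eps eps0; have [d d0 dD] := cc t Dt eps eps0.
rewrite near_withinE; apply/nbhs_ballP; exists d => // s ts Ds.
by rewrite ballEmdist; exact: dD.
Qed.

Lemma continuous_mdistP X (c : R -> X) :
  continuous c <->
  forall t eps, 0 < eps ->
    exists2 d, 0 < d & forall s, `|t - s| < d -> mdist (c t) (c s) < eps.
Proof.
rewrite continuous_subspace_setT within_mdistP; split=> cc t.
  by move=> eps /(cc t I)[d d0 dD]; exists d => // s; exact: dD.
by move=> _ eps /(cc t)[d d0 dD]; exists d => // s _; exact: dD.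
Qed.

Lemma continuous_mdist X Y (f : X -> Y) :
  continuous f ->
  forall x eps, 0 < eps ->
    exists2 d, 0 < d & forall y, mdist x y < d -> mdist (f x) (f y) < eps.
Proof.
move=> cf x eps eps0; have /cvg_ballP/(_ eps eps0)/nbhs_mdistP[d d0 dD] := cf x.
by exists d => // y /dD; rewrite ballEmdist.
Qed.

Lemma mdist_dist X (z x y : X) : `|mdist z x - mdist z y| <= mdist x y.
Proof.
rewrite ler_norml; apply/andP; split.
  have := metric_triangle z x y; lra.
have := metric_triangle z y x; rewrite (metric_sym y x); lra.
Qed.

Lemma connected_clopen X (C P : set X) (x : X) :
  connected C -> C x -> P x ->
  (forall y, C y -> P y ->
    exists2 r : R, 0 < r & forall z, C z -> mdist y z < r -> P z) ->
  (forall y, C y -> ~ P y ->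
    exists2 r : R, 0 < r & forall z, C z -> mdist y z < r -> ~ P z) ->
  C `<=` P.
Proof.
move=> cC Cx Px oP oNP.
suff <- : C `&` P = C by move=> y [].
apply: cC; first by exists x.
  exists (interior (P `|` ~` C)); first exact: open_interior.
  apply/seteqP; split=> y [Cy Py]; split=> //; last first.
    by have [] := interior_subset Py.
  have [r r0 rP] := oP y Cy Py; apply/nbhs_mdistP; exists r => // z yz.
  by have [Cz|nCz] := pselect (C z); [left; exact: rP|right].
exists (~` (interior (~` P `|` ~` C))).
  by apply: open_closedC; exact: open_interior.
apply/seteqP; split=> y [Cy Py]; split=> //.
  by move=> Iy; have [] := interior_subset Iy.
apply: contrapT => nPy; apply: Py.
have [r r0 rP] := oNP y Cy nPy; apply/nbhs_mdistP; exists r => // z yz.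
by have [Cz|nCz] := pselect (C z); [left; exact: rP|right].
Qed.

(** Heine-Borel for a relation on subintervals that is local and additive. It serves to lift curves,
    to compare lengths under a local isometry, and to obtain Lipschitz bounds on lifts. *)
Lemma segment_chain (a b : R) (Q : R -> R -> Prop) : a <= b ->
  (forall u v w, a <= u -> u <= v -> v <= w -> w <= b ->
    Q u v -> Q v w -> Q u w) ->
  (forall u, a <= u <= b -> exists2 d, 0 < d & forall s t,
    a <= s -> s <= t -> t <= b -> `|u - s| < d -> `|u - t| < d -> Q s t) ->
  Q a b.
Proof.
move=> ab Qtr Qloc.
(* Taking the radius [e] along the filter of positive numbers tending to 0 turns the pointwise radii
   into a single one. *)
have := @segment_compact R a b => /compact_near_coveringP/(_ R (0^'+)
  (fun e u => forall s t, a <= s -> s <= t -> t <= b ->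
     `|u - s| < e -> `|u - t| < e -> Q s t)).
move=> /(_ _)[].
  move=> u; rewrite /= in_itv/= => uab; have [d d0 dQ] := Qloc u uab.
  exists (ball u (d / 2), [set e | e < d / 2]) => /=.
    split; first by apply: nbhsx_ballx; rewrite divr_gt0.
    by apply: nbhs_right_lt; rewrite divr_gt0.
  move=> [v e]/= [uv ed] s t as_ st tb vs vt.
  have H w : `|v - w| < e -> `|u - w| < d.
    move=> vw; have := ler_distD v u w; rewrite /ball/= in uv; lra.
  by apply: dQ => //; exact: H.
move=> e /= e0 eQ.
have {eQ}[d d0 dQ] : exists2 d, 0 < d & forall u s t, a <= u <= b ->
    a <= s -> s <= t -> t <= b -> `|u - s| < d -> `|u - t| < d -> Q s t.
  exists (e / 2); first by rewrite divr_gt0.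
  move=> u s t uab; apply: (eQ (e / 2)) => //=.
  - by rewrite sub0r normrN gtr0_norm ?divr_gt0// ltr_pdivrMr// ltr_pMr// ltr1n.
  - by rewrite divr_gt0.
(* The points [a + n (d / 2)], clipped at [b], advance by at most [d / 2 < d], within the uniform
   scale. *)
have H n : Q a (Num.min b (a + n%:R * (d / 2))).
  elim: n => [|n IH].
    rewrite mul0r addr0 min_r//; apply: (dQ a) => //; rewrite ?lexx ?ab//;
    by rewrite subrr normr0.
  set u := Num.min b (a + n%:R * _) in IH; set v := Num.min b _.
  have nd : 0 <= n%:R * (d / 2) by rewrite mulr_ge0// divr_ge0 ?ltW.
  have au : a <= u by rewrite /u le_min ab/= lerDl.
  have ub : u <= b by rewrite /u ge_min lexx.
  have uv : u <= v.
    rewrite /u /v le_min ge_min lexx/= ge_min -natr1 mulrDl mul1r addrA.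
    by apply/orP; right; rewrite lerDl divr_ge0// ltW.
  have vb : v <= b by rewrite /v ge_min lexx.
  have vu : v <= u + d / 2.
    rewrite /u /v -natr1 mulrDl mul1r addrA; set x := a + _.
    have d20 : 0 < d / 2 by rewrite divr_gt0.
    by case: (leP b x) => bx; rewrite ge_min; apply/orP; [left|right]; lra.
  apply: (Qtr _ u) => //; apply: (dQ u) => //; rewrite ?au ?ub//.
    by rewrite subrr normr0.
  by rewrite ler0_norm; lra.
have [n nb] : exists n : nat, b <= a + n%:R * (d / 2).
  have : 0 <= (b - a) / (d / 2).
    by rewrite divr_ge0 ?subr_ge0// divr_ge0// ltW.
  move=> /archi_boundP; rewrite ltr_pdivrMr ?divr_gt0// => H'.
  by exists (Num.bound ((b - a) / (d / 2))); lra.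
by have := H n; rewrite min_l.
Qed.

End MetricBasics.

(** * Curves and oriented edges *)

Section Curves.
Context {R : realType} {X : metricType R}.
Implicit Types (c g : R -> X) (C V A : set X).

Definition polylen c (a : R) s : R :=
  \sum_(p <- zip (a :: s) s) mdist (c p.1) (c p.2).

Lemma polylen_cons c a b s :
  polylen c a (b :: s) = mdist (c a) (c b) + polylen c b s.
Proof. by rewrite /polylen /= big_cons. Qed.

Lemma polylen_nil c a : polylen c a [::] = 0.
Proof. by rewrite /polylen /= big_nil. Qed.

Lemma polylen_cat c a s1 s2 :
  polylen c a (s1 ++ s2) = polylen c a s1 + polylen c (last a s1) s2.
Proof.
elim: s1 a => [|b s1 IH] a /=; first by rewrite polylen_nil add0r.
by rewrite !polylen_cons IH addrA.
Qed.

Lemma polylen_lip c (K a : R) s : path <%R a s ->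
  (forall u v, a <= u -> u <= v -> v <= last a s ->
     mdist (c u) (c v) <= K * (v - u)) ->
  polylen c a s <= K * (last a s - a).
Proof.
elim: s a => [|b s IH] a /=; first by rewrite polylen_nil subrr mulr0.
move=> /andP[ab bs] cK; rewrite polylen_cons.
have bl : b <= last b s.
  case: s bs {IH cK} => [//|x s] /(order_path_min lt_trans)/allP bs.
  by apply/ltW/bs; exact: (mem_last x s).
have := cK a b (lexx _) (ltW ab) bl.
have := IH b bs (fun u v bu => cK u v (le_trans (ltW ab) bu)).
by rewrite (_ : last b s - a = (last b s - b) + (b - a)) ?mulrDr; lra.
Qed.

Lemma curve_length_ge c : ((mdist (c 0) (c 1))%:E <= curve_length c)%E.
Proof.
apply: ereal_sup_ubound; exists [:: 1] => /=.
  by split => //=; rewrite ltr01.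
by rewrite big_cons big_nil addr0.
Qed.

Lemma curve_length_lip c (K : R) :
  (forall u v, 0 <= u -> u <= v -> v <= 1 -> mdist (c u) (c v) <= K * (v - u)) ->
  (curve_length c <= K%:E)%E.
Proof.
move=> cK; apply: ge_ereal_sup => _ [s [ps /eqP ls] <-]; rewrite lee_fin.
by have := @polylen_lip c K 0 s ps; rewrite ls subr0 mulr1; apply.
Qed.

Lemma path_dist_ge C x y : ((mdist x y)%:E <= path_dist C x y)%E.
Proof.
by apply: le_ereal_inf_tmp => _ [c [_ _ <- <-] <-]; exact: curve_length_ge.
Qed.

Lemma path_dist_le C x y c : {within `[0, 1], continuous c} ->
  c @` `[0, 1] `<=` C -> c 0 = x -> c 1 = y ->
  (path_dist C x y <= curve_length c)%E.
Proof. by move=> *; apply: ereal_inf_lbound; exists c. Qed.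

Lemma lip_within c (D : set R) (K : R) :
  (forall u v, D u -> D v -> mdist (c u) (c v) <= K * `|u - v|) ->
  {within D, continuous c}.
Proof.
move=> cK; apply/within_mdistP => t Dt eps eps0.
have K1 : 0 < `|K| + 1 by rewrite ltr_wpDl.
exists (eps / (`|K| + 1)); first by rewrite divr_gt0.
move=> s Ds; rewrite ltr_pdivlMr// => ts; apply: le_lt_trans (cK _ _ Dt Ds) _.
apply: le_lt_trans ts; rewrite mulrC ler_wpM2l//.
by rewrite (le_trans (ler_norm K))// lerDl.
Qed.

Lemma path_dist_seg C g (s t : R) : s <= t ->
  (forall u v, s <= u <= t -> s <= v <= t -> mdist (g u) (g v) <= `|u - v|) ->
  (forall u, s <= u <= t -> C (g u)) ->
  (path_dist C (g s) (g t) <= (t - s)%:E)%E.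
Proof.
move=> st g1 gC; pose c u := g (s + (t - s) * u).
have ts0 : 0 <= t - s by rewrite subr_ge0.
have cin u : 0 <= u -> u <= 1 -> s <= s + (t - s) * u <= t.
  by move=> u0 u1; nra.
have cl u v : `[0, 1]%classic u -> `[0, 1]%classic v ->
    mdist (c u) (c v) <= (t - s) * `|u - v|.
  rewrite /= !in_itv/= => /andP[u0 u1] /andP[v0 v1].
  rewrite (le_trans (g1 _ _ (cin u u0 u1) (cin v v0 v1)))//.
  by rewrite opprD addrACA subrr add0r -mulrBr normrM ger0_norm.
apply: le_trans (path_dist_le (c := c) _ _ _ _) _.
- exact: lip_within cl.
- by move=> _ [u /= + <-]; rewrite in_itv/= => /andP[u0 u1]; apply: gC; exact: cin.
- by rewrite /c mulr0 addr0.
- by rewrite /c mulr1 addrC subrK.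
apply: curve_length_lip => u v u0 uv v1.
have := cl u v; rewrite /= !in_itv/= u0 v1 (le_trans u0 uv) (le_trans uv v1).
by rewrite distrC ger0_norm ?subr_ge0//; apply.
Qed.

(** The reverse inequality fails in general: on a loop, points near the two ends are close in [X]
    but far apart along the edge. *)
Lemma path_isometry_lip C l g : path_isometry C l g ->
  forall s t, 0 < s < l -> 0 < t < l -> mdist (g s) (g t) <= `|s - t|.
Proof.
by move=> [_ gi] s t sl tl; rewrite -lee_fin -(gi s t sl tl); exact: path_dist_ge.
Qed.

Lemma path_isometry_inj C l g : path_isometry C l g ->
  forall s t, 0 < s < l -> 0 < t < l -> g s = g t -> s = t.
Proof.
move=> [_ gi] s t sl tl st.
have := gi s t sl tl; rewrite {}st gi// => -[] /esym/eqP.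
by rewrite subrr normr0 normr_eq0 subr_eq0 => /eqP.
Qed.

Lemma path_isometry_rev C l g : path_isometry C l g ->
  path_isometry C l (fun t => g (l - t)).
Proof.
move=> [gC gi]; split.
  rewrite -gC; apply/seteqP; split=> _ [t /= + <-]; rewrite in_itv/= => tl.
    by exists (l - t) => //=; rewrite in_itv/=; lra.
  by exists (l - t); rewrite /= ?in_itv/= ?opprB ?(addrC _ (t - l)) ?subrK//; lra.
move=> s t sl tl; rewrite gi; [|lra|lra].
by rewrite (_ : l - s - (l - t) = t - s) 1?distrC//; ring.
Qed.

End Curves.

Section OrientedEdges.
Context {R : realType} {X : metricType R}.
Implicit Types (A V : set X) (e : oseg R X).

Lemma barK e : bar (bar e) = e.
Proof.
case: e => l g; rewrite /bar /=; congr OSeg; apply/funext => t.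
by rewrite opprB addrC subrK.
Qed.

Lemma src_bar e : src (bar e) = tgt e.
Proof. by rewrite /src /tgt /bar /= subr0. Qed.

Lemma tgt_bar e : tgt (bar e) = src e.
Proof. by rewrite /src /tgt /bar /= subrr. Qed.

Lemma seg_int_bar e : seg_int (bar e) = seg_int e.
Proof.
case: e => l g; rewrite /seg_int /bar /=.
apply/seteqP; split=> _ [t /= + <-]; rewrite in_itv/= => tl.
  by exists (l - t) => //=; rewrite in_itv/=; lra.
by exists (l - t); rewrite /= ?in_itv/= ?opprB ?(addrC _ (t - l)) ?subrK//; lra.
Qed.

Lemma oedges_bar A V e : oedges A V e -> oedges A V (bar e).
Proof.
move=> [l0 ce [e0 el] [Vs Vt] [x AVx iso]]; split => //.
- move/continuous_mdistP: ce => cm; apply/continuous_mdistP => t eps.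
  move=> /(cm (elen e - t))[d d0 dD]; exists d => // s ts; apply: dD.
  by rewrite (_ : _ - _ = s - t) 1?distrC//; ring.
- rewrite src_bar tgt_bar /bar/=; split=> t tl; [apply: el|apply: e0]; lra.
- by rewrite src_bar tgt_bar.
- by exists x => //; exact: path_isometry_rev.
Qed.

Lemma bar_neq A V e : oedges A V e -> bar e <> e.
Proof.
move=> [l0 _ _ _ [x _ iso]] be.
have E : epar (bar e) (elen e / 4) = epar e (elen e / 4) by rewrite be.
have := path_isometry_inj iso _ _ E; rewrite /bar /= => H.
have : elen e - elen e / 4 = elen e / 4 by apply: H; lra.
lra.
Qed.

Lemma seg_int_mem e t : 0 < t < elen e -> seg_int e (epar e t).
Proof. by move=> tl; exists t => //=; rewrite in_itv. Qed.

Lemma seg_intP e x : seg_int e x -> exists2 t, 0 < t < elen e & epar e t = x.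
Proof. by move=> [t /=]; rewrite in_itv/= => tl <-; exists t. Qed.

Lemma seg_int_component A V e x : oedges A V e -> seg_int e x ->
  seg_int e = connected_component (A `\` V) x.
Proof.
move=> [_ _ _ _ [y _ [Ey _]]]; rewrite /seg_int Ey => yx.
exact: same_connected_component.
Qed.

Lemma seg_int_sub A V e : oedges A V e -> seg_int e `<=` A `\` V.
Proof.
move=> [_ _ _ _ [y _ [Ey _]]]; rewrite /seg_int Ey.
exact: connected_component_sub.
Qed.

Lemma seg_int_eq A V e1 e2 x : oedges A V e1 -> oedges A V e2 ->
  seg_int e1 x -> seg_int e2 x -> seg_int e1 = seg_int e2.
Proof.
move=> E1 E2 x1 x2.
by rewrite (seg_int_component E1 x1) (seg_int_component E2 x2).
Qed.

Lemma seg_int_iso A V e : oedges A V e ->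
  path_isometry (seg_int e) (elen e) (epar e).
Proof.
by move=> E; have [_ _ _ _ [y _ iso]] := E; have [Ey _] := iso; rewrite -Ey in iso.
Qed.

Lemma edge_inj A V e s t : oedges A V e ->
  0 < s < elen e -> 0 < t < elen e -> epar e s = epar e t -> s = t.
Proof. by move=> /seg_int_iso/path_isometry_inj; exact. Qed.

Lemma connected_epar e (a b : R) : continuous (epar e) ->
  connected (epar e @` `[a, b]).
Proof.
move=> ce; apply: connected_continuous_connected; first exact: segment_connected.
exact: continuous_subspaceT.
Qed.

End OrientedEdges.

(** * Stars and openness of edges *)

Section Stars.
Context {R : realType} {X : metricType R}.
Implicit Types (A V : set X) (x y : X) (e : oseg R X).

(** [star_nbhd] normalised so that, inside [A], the star of radius [r] and the ball of radius [r]
    have the same points. *)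
Record star_chart A x (n : nat) (r : R) (f : 'I_n -> R -> X) : Prop := StarChart {
  star_gt0 : 0 < r ;
  star0 : forall k, f k 0 = x ;
  star_dist : forall k j s t, 0 <= s < r -> 0 <= t < r ->
    mdist (f k s) (f j t) = if k == j then `|s - t| else s + t ;
  star_in : forall k t, 0 <= t < r -> A (f k t) ;
  star_centre : A x ;
  star_cover : forall y, A y -> mdist x y < r ->
    y = x \/ exists k t, 0 <= t < r /\ y = f k t }.

Lemma star_nbhd_chart A x n r : 0 < r -> star_nbhd A x n r ->
  exists2 r', 0 < r' & exists f, forall r1, 0 < r1 <= r' -> star_chart A x r1 f (n := n).
Proof.
move=> r0 [f /= [f0 fd fA [W /nbhs_mdistP[r2 r20 r2W] WA]]].
exists (Num.min r r2); first by rewrite lt_min r0.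
exists f => r1 /andP[r10]; rewrite le_min => /andP[r1r r1r2].
have lr t : 0 <= t < r1 -> 0 <= t < r by move=> /andP[-> /lt_le_trans->].
have Ax : A x by apply: fA; left.
split=> //.
- by move=> k j s t /lr sr /lr tr; exact: fd.
- by move=> k t /lr tr; apply: fA; right; exists k, t.
move=> y Ay xy; have [] := WA y; first by split=> //; apply: r2W; lra.
  by left.
move=> [k [t [tr yE]]]; right; exists k, t; split=> //.
move: xy; rewrite yE -(f0 k) fd// ?lexx ?r0// eqxx sub0r normrN.
by case/andP: tr => t0 _; rewrite ger0_norm// t0.
Qed.

Lemma chart_star_nbhd A x n r (f : 'I_n -> R -> X) : star_chart A x r f ->
  star_nbhd A x n r.
Proof.
move=> [r0 f0 fd fA Ax fc]; exists f => /=; split=> //.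
  by move=> y [->//|[k [t [tr ->]]]]; exact: fA.
exists [set y | mdist x y < r]; first by apply/nbhs_mdistP; exists r.
move=> y [/= xy Ay]; have [->|[k [t H]]] := fc y Ay xy; first by left.
by right; exists k, t.
Qed.

Lemma star_mdist A x n r (f : 'I_n -> R -> X) k t : star_chart A x r f ->
  0 <= t < r -> mdist x (f k t) = t.
Proof.
move=> [r0 f0 fd _ _ _] tr; rewrite -(f0 k) fd ?lexx ?r0// eqxx sub0r normrN.
by case/andP: tr => t0 _; rewrite ger0_norm.
Qed.

Lemma metric_graph_chart A x (eps : R) : metric_graph A -> A x -> 0 < eps ->
  exists n r (f : 'I_n -> R -> X), r <= eps /\ star_chart A x r f.
Proof.
move=> [_ _ [d d0 dA]] Ax eps0; have [n [r [dr sr]]] := dA x Ax.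
have [r' r'0 [f fr]] := star_nbhd_chart (lt_le_trans d0 dr) sr.
exists n, (Num.min r' eps), f; split; first by rewrite ge_min lexx orbT.
by apply: fr; rewrite lt_min r'0 eps0/= ge_min lexx.
Qed.

Lemma chart_valence A x n r (f : 'I_n -> R -> X) : star_chart A x r f ->
  has_valence A x n.
Proof. by move=> sf; exists r; [case: sf|exact: chart_star_nbhd sf]. Qed.

(* The arm [k] of a star is parametrised by a 1-Lipschitz function on the whole
   star, which is negative on the other arms; so the intermediate value theorem
   applies to curves in the star that reach arm [k]. *)
Lemma star_curve_arm x n r (f : 'I_n -> R -> X) (c : R -> X) (a b s1 : R) k :
  star_chart [set: X] x r f ->
  {within `[a, b], continuous c} -> a <= b ->
  (forall t, a <= t <= b -> mdist x (c t) < r) ->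
  (c a = x /\ c b = f k s1) \/ (c b = x /\ c a = f k s1) ->
  0 <= s1 < r ->
  forall s, 0 < s <= s1 -> exists2 t, a <= t <= b & c t = f k s.
Proof.
move=> sf cc ab cr cab s1r s /andP[s0 ss1].
pose on_arm y := exists2 t, 0 <= t < r & y = f k t.
pose psi y := if `[< on_arm y >] then mdist x y else - mdist x y.
have psif t : 0 <= t < r -> psi (f k t) = t.
  move=> tr; rewrite /psi; case: asboolP; last by case; exists t.
  by move=> _; rewrite (star_mdist _ sf).
have psi_pos y : 0 < psi y -> y = f k (psi y).
  rewrite /psi; case: asboolP => [[t tr ->]|_]; first by rewrite (star_mdist _ sf).
  by have := mdist_ge0 x y => H1 H2; exfalso; lra.
have psil y z : mdist x y < r -> mdist x z < r -> `|psi y - psi z| <= mdist y z.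
  move=> xy xz.
  have H u w : ~ on_arm w -> mdist x w < r -> on_arm u ->
      mdist x u + mdist x w <= mdist u w.
    move=> nw xw [t tr uE]; have [->|[j [t' [t'r wE]]]] := star_cover sf I xw.
      by rewrite mdistxx addr0 metric_sym.
    have kj : k != j by apply/eqP => kj; apply: nw; exists t'; rewrite // kj.
    rewrite uE wE !(star_mdist _ sf)// (star_dist sf)//.
    by rewrite (negbTE kj).
  have D := mdist_dist x y z; have y0 := mdist_ge0 x y; have z0 := mdist_ge0 x z.
  rewrite /psi; case: asboolP => ay; case: asboolP => az //.
  - by rewrite opprK ger0_norm ?addr_ge0//; exact: H.
  - rewrite ler0_norm; last lra.
    by rewrite (metric_sym y z); have := H z y ay xy az; lra.
  - by rewrite opprK addrC distrC.
have : exists2 t, t \in `[a, b] & (psi \o c) t = s.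
  apply: IVT => //.
    apply/subspace_continuousP => t tab; apply/cvgrPdist_lt => eps eps0.
    move/within_mdistP: cc => /(_ t tab eps eps0)[d d0 dD].
    rewrite near_withinE; apply/nbhs_ballP; exists d => // u tu uab.
    move: (tab) (uab); rewrite /= !in_itv/= => tab' uab'.
    by apply: le_lt_trans (dD u uab tu); apply: psil; exact: cr.
  have psx : psi x = 0 by rewrite /psi; case: ifP => _; rewrite mdistxx ?oppr0.
  have s10 : 0 <= s1 by case/andP: s1r.
  rewrite /=; case: cab => -[-> ->]; rewrite psx psif//.
    by rewrite min_l// max_r//; lra.
  by rewrite min_r// max_l//; lra.
move=> [t]; rewrite in_itv/= => tab ts; exists t => //.
have {}ts : psi (c t) = s by [].
by rewrite -ts; apply: psi_pos; rewrite ts.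
Qed.

(** A point off [V] has valence 2. By [star_curve_arm] each side of the edge at [t0] sweeps out the
    beginning of an arm, the two arms differ because the edge is injective, and so they are all the
    arms. The control of [t] says more than openness: the inverse of the parametrisation is
    continuous. *)
Lemma edge_open V e (t0 d : R) :
  metric_graph [set: X] -> vertex_set [set: X] V -> oedges [set: X] V e ->
  0 < t0 < elen e -> 0 < d ->
  exists2 r : R, 0 < r & forall y, mdist (epar e t0) y < r ->
    exists t, [/\ 0 < t < elen e, `|t0 - t| < d & y = epar e t].
Proof.
move=> mX vV eE t0l d0; set x := epar e t0.
have xV : ~ V x.
  by have [] := seg_int_sub eE (seg_int_mem t0l).
have [n [r [f [_ sf]]]] := metric_graph_chart mX (x := x) I (ltr01).
have n2 : n = 2%N.
  apply: contrapT => n2; apply: xV; case: vV => _ _ + _.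
  by apply; [exact: I|exact: chart_valence sf|exact: n2].
have r0 := star_gt0 sf.
have [_ ce _ _ _] := eE.
move/continuous_mdistP: (ce) => /(_ t0 r r0)[d1 d10 d1r].
(* This [h] keeps [[t0 - h, t0 + h]] inside the edge, within [d] of [t0], and its image inside the
   star. *)
pose h := Num.min (Num.min (d / 2) (d1 / 2)) (Num.min (t0 / 2) ((elen e - t0) / 2)).
have [t00 t0l'] := andP t0l.
have : 0 < h by rewrite /h !lt_min !divr_gt0// subr_gt0.
have : h <= d / 2 by rewrite /h !ge_min lexx.
have : h <= d1 / 2 by rewrite /h !ge_min lexx ?orbT.
have : h <= t0 / 2 by rewrite /h !ge_min lexx ?orbT.
have : h <= (elen e - t0) / 2 by rewrite /h !ge_min lexx ?orbT.
move: (h) => {}h hl ht hd1 hd h0.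
have arm b : `|t0 - b| = h -> exists k s, 0 < s < r /\ epar e b = f k s.
  move=> bh; have xb : mdist x (epar e b) < r by apply: d1r; lra.
  have bl : 0 < b < elen e by move: bh; case: (lerP b t0) => ? ?; lra.
  have bx : epar e b <> x.
    by move=> /(edge_inj eE bl t0l) bt0; move: bh; rewrite bt0 subrr normr0; lra.
  have [//|[k [s [/andP[s0 sr] bs]]]] := star_cover sf I xb.
  exists k, s; split=> //; rewrite sr andbT lt_neqAle s0 andbT eq_sym.
  by apply/eqP => s00; apply: bx; rewrite bs s00 (star0 sf).
have [k1 [s1 [s1r E1]]] : exists k s, 0 < s < r /\ epar e (t0 + h) = f k s.
  by apply: arm; rewrite opprD addrA subrr add0r normrN gtr0_norm.
have [k2 [s2 [s2r E2]]] : exists k s, 0 < s < r /\ epar e (t0 - h) = f k s.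
  by apply: arm; rewrite opprB addrC subrK gtr0_norm.
have [s10 s1r'] := andP s1r; have [s20 s2r'] := andP s2r.
have near_r t : t0 - h <= t <= t0 + h -> mdist x (epar e t) < r.
  by move=> th; apply: d1r; rewrite ltr_distlC; lra.
have R1 s : 0 < s <= s1 -> exists2 t, t0 <= t <= t0 + h & epar e t = f k1 s.
  apply: (star_curve_arm sf) => //; [exact: continuous_subspaceT|lra| |by left|lra].
  by move=> t th; apply: near_r; lra.
have R2 s : 0 < s <= s2 -> exists2 t, t0 - h <= t <= t0 & epar e t = f k2 s.
  apply: (star_curve_arm sf) => //; [exact: continuous_subspaceT|lra| |by right|lra].
  by move=> t th; apply: near_r; lra.
(* On a common arm, one point would have a parameter on each side of [t0]; by injectivity it would
   be the centre. *)
have k12 : k1 != k2.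
  apply/eqP => k12; pose s := Num.min s1 s2.
  have sm : [/\ 0 < s, s <= s1 & s <= s2].
    by rewrite /s lt_min s10 s20 !ge_min !lexx orbT.
  have [s0 ss1 ss2] := sm.
  have [t th tE] := R1 s ltac:(lra); have [t' th' t'E] := R2 s ltac:(lra).
  have tt' : t = t' by apply: (edge_inj eE); [lra|lra|rewrite tE t'E k12].
  have tt0 : t = t0 by lra.
  have := star_mdist k1 sf (t := s); rewrite -tE tt0 -/x mdistxx => H.
  have : 0 = s by apply: H; lra.
  lra.
exists (Num.min s1 s2); first by rewrite lt_min s10.
move=> y; rewrite lt_min => /andP[ys1 ys2].
have [->|[k [s [sr yE]]]] := star_cover sf I (lt_trans ys1 s1r').
  by exists t0; split=> //; rewrite subrr normr0.
have sxy := star_mdist k sf sr; rewrite -yE in sxy.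
rewrite sxy in ys1 ys2.
have [s0|s0] := eqVneq s 0.
  by exists t0; split=> //; [rewrite subrr normr0|rewrite yE s0 (star0 sf)].
have s0' : 0 < s by rewrite lt_neqAle eq_sym s0; case/andP: sr.
have : k = k1 \/ k = k2.
  subst n; move: k k1 k2 k12 {R1 R2 E1 E2 yE sxy} => [[|[|//]] ?] [[|[|//]] ?] [[|[|//]] ?] //= _;
  by [left; exact: val_inj|right; exact: val_inj].
case=> kE.
  have [t th tE] := R1 s ltac:(lra).
  by exists t; rewrite yE kE; split=> //; [lra|rewrite ltr_distlC; lra].
have [t th tE] := R2 s ltac:(lra).
by exists t; rewrite yE kE; split=> //; [lra|rewrite ltr_distlC; lra].
Qed.

Lemma seg_int_open V e : metric_graph [set: X] -> vertex_set [set: X] V ->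
  oedges [set: X] V e -> open (seg_int e).
Proof.
move=> mX vV eE; rewrite openE => x /seg_intP[t tl <-]; apply/nbhs_mdistP.
have [r r0 rP] := edge_open mX vV eE tl ltr01.
by exists r => // y /rP[u [ul _ ->]]; exact: seg_int_mem.
Qed.

End Stars.

(** * Uniqueness and completion of edges *)

Section EdgeUniqueness.
Context {R : realType} {X : metricType R}.
Implicit Types (A V : set X) (e : oseg R X).

Lemma eq_oseg_interior e1 e2 : 0 < elen e1 -> elen e1 = elen e2 ->
  continuous (epar e1) -> continuous (epar e2) ->
  (forall t, t <= 0 -> epar e1 t = src e1) ->
  (forall t, elen e1 <= t -> epar e1 t = tgt e1) ->
  (forall t, t <= 0 -> epar e2 t = src e2) ->
  (forall t, elen e2 <= t -> epar e2 t = tgt e2) ->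
  (forall t, 0 < t < elen e1 -> epar e1 t = epar e2 t) -> e1 = e2.
Proof.
case: e1 e2 => l g1 [_ g2]/= l0 <-; rewrite /src /tgt /= => c1 c2 s1 t1 s2 t2 par.
have ends t : (forall d, 0 < d -> exists2 u, 0 < u < l & `|t - u| < d) -> g1 t = g2 t.
  move=> dense; apply: mdist_positivity; apply/eqP; rewrite eq_le mdist_ge0 andbT.
  apply/ler_addgt0Pr => eps eps0; rewrite add0r.
  move/continuous_mdistP: c1 => /(_ t (eps / 2) ltac:(lra))[d1 d10 D1].
  move/continuous_mdistP: c2 => /(_ t (eps / 2) ltac:(lra))[d2 d20 D2].
  have [u ul] := dense (Num.min d1 d2) ltac:(by rewrite lt_min d10).
  rewrite lt_min => /andP[/D1 u1 /D2 u2].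
  have := metric_triangle (g1 t) (g1 u) (g2 t).
  by rewrite (metric_sym (g1 u)) {2}(par u ul); lra.
have e0 : g1 0 = g2 0.
  apply: ends => d d0; exists (Num.min (d / 2) (l / 2)).
    by rewrite lt_min gt_min !divr_gt0//= (_ : l / 2 < l) ?orbT//; lra.
  rewrite sub0r normrN gtr0_norm ?lt_min ?divr_gt0// gt_min.
  by rewrite (_ : d / 2 < d)//; lra.
have el : g1 l = g2 l.
  apply: ends => d d0; exists (l - Num.min (d / 2) (l / 2)).
    rewrite subr_gt0 gt_min (_ : l / 2 < l) ?orbT/=; last lra.
    by rewrite ltrBlDr ltrDl lt_min !divr_gt0.
  rewrite opprB addrC subrK gtr0_norm ?lt_min ?divr_gt0// gt_min.
  by rewrite (_ : d / 2 < d)//; lra.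
congr OSeg; apply/funext => t.
have [t0|t0] := leP t 0; first by rewrite s1// s2.
have [tl|tl] := leP l t; first by rewrite t1// t2.
by apply: par; rewrite t0.
Qed.

(** The predicates [P e] and [P (bar e)] agree, so [choose] gives both orientations the same
    representative; [O] keeps the edges that represent themselves. *)
Lemma orientation_exists A V :
  exists O, orientation (oedges A V) O.
Proof.
pose P e : pred (oseg R X) := [pred e' | (e' == e) || (e' == bar e)].
have Pbar e : P (bar e) =1 P e.
  by move=> e'; rewrite /P/= barK orbC.
pose rep e := choose (P e) e.
have repb e : rep (bar e) = rep e.
  rewrite /rep (eq_choose (Pbar e)); apply: choose_id; rewrite /P/= ?eqxx ?orbT//.
have repP e : rep e = e \/ rep e = bar e.
  have : P e (rep e) by apply: chooseP; rewrite /P/= eqxx.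
  by rewrite /P/= => /orP[/eqP|/eqP]; [left|right].
exists [set e | oedges A V e /\ rep e = e]; split; first by move=> e [].
move=> e Ee; have ne := bar_neq Ee.
have [re|re] := repP e.
  by left; split=> // -[_]; rewrite repb re => /esym.
by right; split=> [[_]|]; [rewrite re|split; [exact: oedges_bar|rewrite repb]].
Qed.

End EdgeUniqueness.
Section EdgeCompletion.
Context {R : realType} {X : metricType R}.
Implicit Types (A C V : set X) (x y : X) (e : oseg R X).

(** A cluster point at [0] suffices: the Lipschitz bound makes it the limit, at the stated speed. *)
Lemma path_isometry_limit C l (g : R -> X) :
  compact [set: X] -> 0 < l -> path_isometry C l g ->
  exists p, forall t, 0 < t < l -> mdist p (g t) <= t.
Proof.
move=> cX l0 iso; have [p [_ pcl]] := cX (g @ 0^'+) _ filterT.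
exists p => t /andP[t0 tl]; apply/ler_addgt0Pr => eps eps0.
have d0 : 0 < Num.min (eps / 2) l by rewrite lt_min l0 divr_gt0.
have [y [[s /= ss <-] ys]] : (g @` `]0, Num.min (eps / 2) l[) `&` ball p (eps / 2) !=set0.
  apply: pcl; last by apply: nbhsx_ballx; rewrite divr_gt0.
  rewrite nbhs_simpl/=; near=> s; exists s => //=; rewrite in_itv/=.
  by apply/andP; split; near: s; [exact: nbhs_right_gt|exact: nbhs_right_lt].
move: ss ys; rewrite ballEmdist in_itv/= lt_min => /andP[s0 /andP[s1 sl]] ps.
have tr := metric_triangle p (g s) (g t).
have := path_isometry_lip iso (s := s) (t := t); rewrite s0 sl t0 tl => /(_ isT isT).
have := ler_normB s t; rewrite (gtr0_norm s0) (gtr0_norm t0); lra.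
Unshelve. all: by end_near. Qed.

(* Were [p] in [C], say [p = g s], the curve [g] would run from [p] to [g t] in
   length [t] for small [t], against [path_dist C p (g t) = s - t]. *)
Lemma path_isometry_end A V x l (g : R -> X) p :
  0 < l -> path_isometry (connected_component (A `\` V) x) l g ->
  A p -> (forall t, 0 < t < l -> mdist p (g t) <= t) -> V p.
Proof.
move=> l0 iso Ap pg; apply: contrapT => nVp.
pose h t := if t <= 0 then p else g t.
have h1 u v : 0 <= u < l -> 0 <= v < l -> mdist (h u) (h v) <= `|u - v|.
  move=> /andP[u0 ul] /andP[v0 vl]; rewrite /h.
  case: (leP u 0) => u0'; case: (leP v 0) => v0'.
  - by rewrite mdistxx.
  - have -> : u = 0 by lra.
    by rewrite sub0r normrN gtr0_norm//; apply: pg; lra.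
  - have -> : v = 0 by lra.
    by rewrite subr0 gtr0_norm// metric_sym; apply: pg; lra.
  - by apply: (path_isometry_lip iso); lra.
have h0 : h 0 = p by rewrite /h lexx.
have hg t : 0 < t -> h t = g t by rewrite /h ltNge => /negbTE ->.
have gC t : 0 < t < l -> connected_component (A `\` V) x (g t).
  by move=> tl; have [<- _] := iso; exists t => //=; rewrite in_itv.
have hC : connected_component (A `\` V) x p.
  have gl : connected_component (A `\` V) x (g (l / 2)) by apply: gC; lra.
  apply: connected_component_trans gl _.
  exists (h @` `[0, l / 2]).
    split.
    - exists (l / 2); last by rewrite hg ?divr_gt0.
      by rewrite /= in_itv/=; lra.
    - move=> _ [t /= + <-]; rewrite in_itv/= => tl; rewrite /h; case: leP => // t0.
      by have /connected_component_sub := gC t ltac:(lra).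
    - apply: connected_continuous_connected; first exact: segment_connected.
      apply: (lip_within (K := 1)) => u v; rewrite /= !in_itv/= mul1r => ul vl.
      by apply: h1; lra.
  by exists 0 => //; rewrite /= in_itv/=; lra.
have [s sl ps] : exists2 s, 0 < s < l & g s = p.
  have [E _] := iso; move: hC; rewrite -E => -[s /=]; rewrite in_itv/= => sl gs.
  by exists s.
(* At parameter [s / 4] the two values to compare are [s / 4] and [3 s / 4]. *)
have : (path_dist (connected_component (A `\` V) x) (h 0%R) (h (s / 4)%R) <= (s / 4 - 0)%:E)%E.
  apply: path_dist_seg; first lra.
    by move=> u v us vs; apply: h1; lra.
  move=> u us; rewrite /h; case: leP => // u0; apply: gC; lra.
have [_ iso2] := iso; rewrite h0 hg ?divr_gt0//; last by case/andP: sl.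
rewrite -ps iso2; [|lra|lra].
by rewrite lee_fin ger0_norm; lra.
Qed.

(** [vertex_set] supplies an isometry of an open interval only. Its missing ends are limit points,
    provided by compactness, and [path_isometry_end] puts them in [V]. *)
Lemma component_oedge V x : compact [set: X] -> vertex_set [set: X] V ->
  ~ V x -> exists2 e, oedges [set: X] V e & seg_int e x.
Proof.
move=> cX [_ _ _ /(_ x)] vc nVx; have Ax : ([set: X] `\` V) x by [].
have [l [g [l0 iso]]] := vc Ax.
have [p pg] := path_isometry_limit cX l0 iso.
have [q qg] := path_isometry_limit cX l0 (path_isometry_rev iso).
have Vp : V p := path_isometry_end l0 iso I pg.
have Vq : V q := path_isometry_end l0 (path_isometry_rev iso) I qg.
have qg' t : 0 < t < l -> mdist q (g t) <= l - t.
  by move=> tl; have := qg (l - t); rewrite (_ : l - (l - t) = t); [apply; lra|ring].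
pose h t := if t <= 0 then p else if t < l then g t else q.
have hp t : t <= 0 -> h t = p by rewrite /h => ->.
have hq t : l <= t -> h t = q.
  by move=> lt; rewrite /h leNgt (lt_le_trans l0 lt)/= ltNge lt.
have hp0 : h 0 = p by rewrite hp.
have hql : h l = q by rewrite hq.
have pq : mdist p q <= l.
  have := metric_triangle p (g (l / 2)) q; rewrite (metric_sym (g (l / 2))).
  have := pg (l / 2) ltac:(lra); have := qg' (l / 2) ltac:(lra); lra.
have h1 u v : u <= v -> mdist (h u) (h v) <= v - u.
  rewrite /h => uv; case: (leP u 0) => u0; case: (leP v 0) => v0; try lra.
  - by rewrite mdistxx; lra.
  - case: (ltP v l) => vl; last lra.
    by have := pg v ltac:(lra); lra.
  case: (ltP u l) => ul; case: (ltP v l) => vl; try lra.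
  - by have := path_isometry_lip iso (s := u) (t := v); rewrite distrC ger0_norm; [apply; lra|lra].
  - by have := qg' u ltac:(lra); rewrite metric_sym; lra.
  - by rewrite mdistxx; lra.
have hg t : 0 < t < l -> h t = g t.
  by move=> /andP[t0 tl]; rewrite /h tl leNgt t0.
have iso' : path_isometry (connected_component ([set: X] `\` V) x) l h.
  split.
    have [<- _] := iso; apply/seteqP; split=> _ [t /= tl <-]; exists t => //=;
    by rewrite hg//; move: tl; rewrite in_itv.
  by move=> s t sl tl; rewrite !hg//; case: iso => _; exact.
exists (OSeg l h).
  split=> //=.
  - rewrite continuous_subspace_setT; apply: (lip_within (K := 1)) => u v _ _.
    rewrite mul1r; case: (leP u v) => uv; first by rewrite distrC ger0_norm ?subr_ge0//; exact: h1.
    by rewrite metric_sym gtr0_norm ?subr_gt0//; apply: h1; exact: ltW.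
  - by rewrite /src /tgt/= hp0 hql; split=> t; [exact: hp|exact: hq].
  - by rewrite /src /tgt /= hp0 hql.
  - by exists x.
rewrite /seg_int; have [-> _] := iso'; exact: connected_component_refl.
Qed.

(** A point of the line is determined by its distances to two distinct points. *)
Lemma isometry_line (a b t u v w : R) : a < b -> v = u + (b - a) ->
  `|w - u| = `|t - a| -> `|w - v| = `|t - b| -> w = u + (t - a).
Proof.
move=> ab ->; case: (lerP w u) => ?; case: (lerP t a) => ?; move=> ?;
  by case: (lerP t b) => ?; case: lerP => ? ?; lra.
Qed.

Lemma le_of_small (a l u : R) : 0 < l ->
  (forall t, 0 < t < l -> u <= t + a) -> u <= a.
Proof.
move=> l0 H; apply/ler_addgt0Pr => eps eps0.
have [m [m0 me ml]] : exists m, [/\ 0 < m, m <= eps & m <= l / 2].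
  exists (Num.min eps (l / 2)).
  by rewrite lt_min eps0 divr_gt0// !ge_min !lexx orbT.
by have := H m ltac:(lra); lra.
Qed.

(* An isometry between open intervals is a translation or a reflection. *)
Lemma seg_int_unique A V e1 e2 : oedges A V e1 -> oedges A V e2 ->
  seg_int e1 = seg_int e2 -> e1 = e2 \/ e1 = bar e2.
Proof.
move=> E1 E2 E12; have [l10 c1 [s1 t1] _ _] := E1; have [l20 c2 [s2 t2] _ _] := E2.
have [_ i1] := seg_int_iso E1; have [_ i2] := seg_int_iso E2.
have [k [sg [sgE kE]]] : exists (k sg : R), (sg = 1 \/ sg = -1) /\ forall t, 0 < t < elen e1 ->
    0 < k + sg * t < elen e2 /\ epar e1 t = epar e2 (k + sg * t).
  have H t : 0 < t < elen e1 -> exists2 u, 0 < u < elen e2 & epar e2 u = epar e1 t.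
    by move=> tl; apply: seg_intP; rewrite -E12; exact: seg_int_mem.
  have D s t u v : 0 < s < elen e1 -> 0 < t < elen e1 -> 0 < u < elen e2 ->
      0 < v < elen e2 -> epar e2 u = epar e1 s -> epar e2 v = epar e1 t ->
      `|u - v| = `|s - t|.
    move=> sl tl ul vl us vt; apply: EFin_inj.
    by rewrite -(i1 s t)// -(i2 u v)// us vt E12.
  (* Two reference points; whether the change of parameter keeps their order decides between
     translation and reflection. *)
  pose a := elen e1 / 3; pose b := 2 * elen e1 / 3.
  have al : 0 < a < elen e1 by rewrite /a; lra.
  have bl : 0 < b < elen e1 by rewrite /b; lra.
  have ab : a < b by rewrite /a /b; lra.
  have [u ul uE] := H a al; have [v vl vE] := H b bl.
  have uv := D _ _ _ _ al bl ul vl uE vE.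
  have [uv'|uv'] := leP u v.
    exists (u - a), 1; split; first by left.
    move=> t tl; have [w wl wE] := H t tl.
    have wu := D _ _ _ _ tl al wl ul wE uE; have wv := D _ _ _ _ tl bl wl vl wE vE.
    have -> : u - a + 1 * t = w.
      suff -> : w = u + (t - a) by ring.
      apply: (isometry_line ab _ wu wv); move: uv.
      by case: (lerP u v) uv' => // _ _; case: (lerP a b) ab => [_ _|]; lra.
    by split.
  exists (u + a), (-1); split; first by right.
  move=> t tl; have [w wl wE] := H t tl.
  have wu := D _ _ _ _ tl al wl ul wE uE; have wv := D _ _ _ _ tl bl wl vl wE vE.
  have -> : u + a + (-1) * t = w.
    have -> : w = - (- u + (t - a)); last ring.
    apply/eqP; rewrite -eqr_oppLR; apply/eqP; apply: (isometry_line (v := - v) ab).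
    - by move: uv; case: (lerP u v) uv' => // _ _; case: (lerP a b) ab => [_ _|]; lra.
    - by rewrite -wu opprK addrC distrC.
    - by rewrite -wv opprK addrC distrC.
  by split.
have sur u : 0 < u < elen e2 -> exists2 t, 0 < t < elen e1 & k + sg * t = u.
  move=> ul; have [t tl tE] : exists2 t, 0 < t < elen e1 & epar e1 t = epar e2 u.
    by apply: seg_intP; rewrite E12; exact: seg_int_mem.
  have [kl kE'] := kE t tl; exists t => //; apply: (edge_inj E2) => //.
  by rewrite -kE'.
(* Letting parameters tend to the ends of both intervals fixes [k] and forces the lengths to
   agree. *)
case: sgE => sgE; rewrite {}sgE in kE sur; [left|right].
  have k0 : k = 0.
    apply/eqP; rewrite eq_le; apply/andP; split.
      apply: (@le_of_small 0 (elen e2)) => // t tl; have [u ul <-] := sur t tl; lra.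
    rewrite -oppr_le0; apply: (@le_of_small 0 (elen e1)) => // t tl; have [] := kE t tl; lra.
  have l12 : elen e1 = elen e2.
    apply/eqP; rewrite eq_le; apply/andP; split.
      apply: (@le_of_small _ (elen e1)) => // t tl.
      by have [] := kE (elen e1 - t) ltac:(lra); lra.
    apply: (@le_of_small _ (elen e2)) => // t tl.
    by have [u ul] := sur (elen e2 - t) ltac:(lra); lra.
  have par t : 0 < t < elen e1 -> epar e1 t = epar e2 t.
    by move=> /kE[_ ->]; rewrite k0 add0r mul1r.
  clear - par l12 l10 c1 c2 s1 s2 t1 t2; exact: eq_oseg_interior.
have kl2 : k = elen e2.
  apply/eqP; rewrite eq_le; apply/andP; split.
    apply: (@le_of_small _ (elen e1)) => // t tl.
    by have [] := kE t tl; lra.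
  rewrite -subr_le0; apply: (@le_of_small 0 (elen e2)) => // t tl.
  by have [u ul] := sur (elen e2 - t) ltac:(lra); lra.
have l12 : elen e1 = elen e2.
  apply/eqP; rewrite eq_le; apply/andP; split.
    apply: (@le_of_small _ (elen e1)) => // t tl.
    by have [] := kE (elen e1 - t) ltac:(lra); lra.
  apply: (@le_of_small _ (elen e2)) => // t tl.
  by have [u ul] := sur t tl; lra.
have [_ c2b [s2b t2b] _ _] := oedges_bar E2.
apply: eq_oseg_interior => // t tl /=.
by have [_ ->] := kE t tl; rewrite kl2 mulN1r.
Qed.

End EdgeCompletion.

(** * Covering maps *)

Section VertexStars.
Context {R : realType} {X : metricType R}.
Implicit Types (V : set X) (x v : X) (e : oseg R X).

Definition punctured_star V n (r : R) (f : 'I_n -> R -> X) : Prop :=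
  forall k t, 0 < t < r -> ~ V (f k t).

Lemma isolated_chart V v (eps : R) : metric_graph [set: X] -> isolated V v -> 0 < eps ->
  exists n r (f : 'I_n -> R -> X),
    [/\ r <= eps, star_chart [set: X] v r f & punctured_star V r f].
Proof.
move=> mX [Vv [W /nbhs_mdistP[d d0 dW] WV]] eps0.
have [n [r [f [rd sf]]]] := @metric_graph_chart _ _ _ v (Num.min d eps) mX I
  ltac:(by rewrite lt_min d0).
have [rd' re] : r <= d /\ r <= eps by move: rd; rewrite le_min => /andP[].
exists n, r, f; split=> // k t /andP[t0 tr] Vf.
have ftt : mdist v (f k t) = t by rewrite (star_mdist k sf)// tr ltW.
have : (W `&` V) (f k t) by split=> //; apply: dW; rewrite ftt; lra.
by rewrite WV /= => fv; move: ftt; rewrite fv mdistxx; lra.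
Qed.

Lemma star_arm_within n r (f : 'I_n -> R -> X) v k (D : set R) :
  star_chart [set: X] v r f ->
  D `<=` [set t | 0 <= t < r] -> {within D, continuous (f k)}.
Proof.
move=> sf Dr; apply: (lip_within (K := 1)) => s t /Dr/= sr /Dr/= tr.
by rewrite (star_dist sf)// eqxx mul1r.
Qed.

Lemma arm_connected n r (f : 'I_n -> R -> X) v k a b :
  star_chart [set: X] v r f -> 0 <= a -> b < r -> connected (f k @` `[a, b]).
Proof.
move=> sf a0 br; apply: connected_continuous_connected; first exact: segment_connected.
apply: (star_arm_within sf) => t /=; rewrite in_itv/=; lra.
Qed.

Lemma arm_in_edge V n r (f : 'I_n -> R -> X) v k e t :
  star_chart [set: X] v r f -> punctured_star V r f ->
  oedges [set: X] V e -> 0 < t < r -> seg_int e (f k t) ->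
  forall s, 0 < s < r -> seg_int e (f k s).
Proof.
move=> sf pf eE tr et s sr; rewrite (seg_int_component eE et).
have [m0 M1] : 0 < Num.min s t /\ Num.max s t < r.
  by rewrite lt_min gt_max; lra.
apply: (connected_component_max (B := f k @` `[Num.min s t, Num.max s t])).
- by exists t => //; rewrite /= in_itv/= ge_min le_max lexx !orbT.
- move=> _ [u /= + <-]; rewrite in_itv/= => us; split=> //; apply: pf; lra.
- by apply: (arm_connected sf) => //; exact: ltW.
- by exists s => //; rewrite /= in_itv/= ge_min le_max lexx.
Qed.

(** Near its end the edge enters the punctured star, and a punctured arm is connected and misses
    [V], so it lies in a single component. *)
Lemma edge_contains_arm V n r (f : 'I_n -> R -> X) v e :
  star_chart [set: X] v r f -> punctured_star V r f -> V v ->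
  oedges [set: X] V e -> tgt e = v ->
  exists k, forall s, 0 < s < r -> seg_int e (f k s).
Proof.
move=> sf pf Vv eE ev; have [l0 ce _ _ _] := eE.
move/continuous_mdistP: ce => /(_ (elen e) r (star_gt0 sf))[d d0 dr].
pose h := Num.min (d / 2) (elen e / 2).
have h0 : 0 < h by rewrite lt_min !divr_gt0.
have hd : h <= d / 2 by rewrite ge_min lexx.
have hl : h <= elen e / 2 by rewrite ge_min lexx orbT.
have et : seg_int e (epar e (elen e - h)) by apply: seg_int_mem; lra.
have xr : mdist v (epar e (elen e - h)) < r.
  by rewrite -ev; apply: dr; rewrite opprB addrC subrK gtr0_norm//; lra.
have [_ nV] := seg_int_sub eE et.
have [vE|[k [t [tr tE]]]] := star_cover sf I xr; first by rewrite vE in nV.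
have t0 : t != 0.
  by apply/eqP => t0; move: nV; rewrite tE t0 (star0 sf).
exists k; apply: (arm_in_edge (t := t) sf pf eE); last by rewrite -tE.
by rewrite lt_neqAle eq_sym t0.
Qed.

Lemma finite_edges_through V x :
  finite_set [set e | oedges [set: X] V e /\ seg_int e x].
Proof.
have [[e0 [E0 x0]]|N] := pselect (exists e, oedges [set: X] V e /\ seg_int e x).
  apply: (@sub_finite_set _ _ [set e0; bar e0]); last exact: finite_set2.
  by move=> e [Ee ex]; apply: (seg_int_unique Ee E0 (seg_int_eq Ee E0 ex x0)).
rewrite (_ : [set _ | _] = set0); first exact: finite_set0.
by apply/seteqP; split=> // e Ee; apply: N; exists e.
Qed.

(** Each edge ending at [v] contains one of finitely many arms, and a point lies on at most two
    oriented edges. The finiteness is essential for computing with [dstar], since a sum over an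
    infinite support defaults to 0. *)
Lemma finite_edges_tgt V v : metric_graph [set: X] -> vertex_set [set: X] V ->
  V v -> finite_set [set e | oedges [set: X] V e /\ tgt e = v].
Proof.
move=> mX [_ Vi _ _] Vv.
have [n [r [f [_ sf pf]]]] := isolated_chart mX (Vi _ Vv) ltr01.
have r0 := star_gt0 sf.
apply: (@sub_finite_set _ _ (\bigcup_(k in [set: 'I_n])
  [set e | oedges [set: X] V e /\ seg_int e (f k (r / 2))])).
  move=> e [Ee ev]; have [k ks] := edge_contains_arm sf pf Vv Ee ev.
  by exists k => //; split=> //; apply: ks; lra.
by apply: bigcup_finite => // k _; exact: finite_edges_through.
Qed.

Lemma finite_edges_src V v : metric_graph [set: X] -> vertex_set [set: X] V ->
  V v -> finite_set [set e | oedges [set: X] V e /\ src e = v].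
Proof.
move=> mX vV Vv; apply: (@sub_finite_set _ _ (@bar R X @`
  [set e | oedges [set: X] V e /\ tgt e = v])).
  move=> e [Ee ev]; exists (bar e); last exact: barK.
  by split; [exact: oedges_bar|rewrite tgt_bar].
by apply: finite_image; exact: finite_edges_tgt.
Qed.

End VertexStars.

(** * Lifting curves and comparing their lengths *)

Section CoveringMaps.
Context {R : realType}.

Lemma glue_continuous (X : metricType R) (c1 c2 : R -> X) (v : R) :
  continuous c1 -> continuous c2 -> c1 v = c2 v ->
  continuous (fun t => if t <= v then c1 t else c2 t).
Proof.
move=> /continuous_mdistP h1 /continuous_mdistP h2 cv.
apply/continuous_mdistP => t eps eps0.
have [d1 d10 D1] := h1 t (eps / 3) ltac:(lra).
have [d2 d20 D2] := h2 t (eps / 3) ltac:(lra).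
exists (Num.min d1 d2); first by rewrite lt_min d10.
move=> s; rewrite lt_min => /andP[s1 s2].
have vd : `|t - v| <= `|t - s| -> [/\ mdist (c1 t) (c1 v) < eps / 3
                                & mdist (c2 t) (c2 v) < eps / 3].
  by move=> vs; split; [apply: D1|apply: D2]; apply: le_lt_trans vs _.
case: (leP t v) => tv; case: (leP s v) => sv.
- by have := D1 _ s1; lra.
- have [|v1 v2] := vd; first by rewrite !ler0_norm; lra.
  have tr1 := metric_triangle (c1 t) (c1 v) (c2 s); rewrite {2}cv in tr1.
  have := metric_triangle (c2 v) (c2 t) (c2 s); rewrite (metric_sym (c2 v) (c2 t)).
  by have := D2 _ s2; lra.
- have [|v1 v2] := vd; first by rewrite !ger0_norm; lra.
  have tr1 := metric_triangle (c2 t) (c2 v) (c1 s); rewrite -{2}cv in tr1.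
  have := metric_triangle (c1 v) (c1 t) (c1 s); rewrite (metric_sym (c1 v) (c1 t)).
  by have := D1 _ s1; lra.
- by have := D2 _ s2; lra.
Qed.

Lemma clamp_lip (s t x y : R) :
  `|Num.max s (Num.min x t) - Num.max s (Num.min y t)| <= `|x - y|.
Proof.
wlog xy : x y / x <= y => [H|].
  by have [/H//|/ltW/H] := leP x y; rewrite distrC (distrC y).
have m1 : Num.min x t <= Num.min y t by rewrite le_min !ge_min xy lexx orbT.
have m2 : Num.min y t <= Num.min x t + (y - x).
  by case: (leP x t) => xt; rewrite ge_min; apply/orP; [left|right]; lra.
move: (Num.min x t) (Num.min y t) m1 m2 => p q m1 m2.
case: (leP s p) => sp; case: (leP s q) => sq; rewrite (distrC x y) (ger0_norm (_ : 0 <= y - x)) ?ler_norml; lra.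
Qed.

Context {X' X : metricType R} (phi : X' -> X).

Lemma evenly_covered_section U y : open U -> U (phi y) -> evenly_covered phi U ->
  exists g : X -> X', [/\ forall x, U x -> phi (g x) = x, g (phi y) = y &
    forall x, U x -> forall eps : R, 0 < eps -> exists2 d : R, 0 < d &
      forall x', mdist x x' < d -> U x' /\ mdist (g x) (g x') < eps].
Proof.
move=> oU Uy [F [FU _ FS]].
have [S FSS Sy] : (\bigcup_(S in F) S) y by rewrite -FU.
have [_ [g [gc _ gphi gS]]] := FS S FSS; exists g; split=> //; first exact: gS.
move=> x Ux eps eps0; move/subspace_continuousP: gc => /(_ x Ux)/cvg_ballP/(_ _ eps0).
rewrite near_withinE => /nbhs_mdistP[d d0 dU].
move: oU; rewrite openE => /(_ x Ux)/nbhs_mdistP[d' d'0 d'U].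
exists (Num.min d d'); first by rewrite lt_min d0.
move=> x'; rewrite lt_min => /andP[/dU + /d'U Ux'] => /(_ Ux').
by rewrite ballEmdist.
Qed.

(** The starting parameter [u] may be interior: chaining then lifts first the interval that contains
    [u] and continues through the common end, in either direction. Edges are lifted from an interior
    point in this way. *)
Lemma path_lifting (c : R -> X) a b u y : universal_covering phi ->
  continuous c -> a <= u <= b -> phi y = c u ->
  exists c', [/\ continuous c', forall t, a <= t <= b -> phi (c' t) = c t & c' u = y].
Proof.
move=> [_ _ _ ev _] cc uab.
pose Q a b := forall u y, a <= u <= b -> phi y = c u ->
  exists c', [/\ continuous c', forall t, a <= t <= b -> phi (c' t) = c t & c' u = y].
suff : Q a b by exact.
apply: segment_chain; first lra.
  move=> s v t _ sv vt _ Q1 Q2 w z wst zw.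
  have [wv|wv] := leP w v.
    have [c1 [c1c c1l c1w]] := Q1 w z ltac:(lra) zw.
    have [c2 [c2c c2l c2w]] := Q2 v (c1 v) ltac:(lra) (c1l v ltac:(lra)).
    exists (fun t => if t <= v then c1 t else c2 t); split.
    - exact: glue_continuous.
    - by move=> x xst; case: leP => xv; [apply: c1l|apply: c2l]; lra.
    - by rewrite wv.
  have [c2 [c2c c2l c2w]] := Q2 w z ltac:(lra) zw.
  have [c1 [c1c c1l c1w]] := Q1 v (c2 v) ltac:(lra) (c2l v ltac:(lra)).
  exists (fun t => if t <= v then c1 t else c2 t); split.
  - exact: glue_continuous.
  - by move=> x xst; case: leP => xv; [apply: c1l|apply: c2l]; lra.
  - by rewrite leNgt wv.
move=> v vab; have [U [oU Uv evU]] := ev (c v).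
have := oU; rewrite openE => /(_ _ Uv)/nbhs_mdistP[r r0 rU].
move/continuous_mdistP: (cc) => /(_ v r r0)[d d0 dr].
exists d => // s t as_ st tb sd td w z wst zw.
have cU x : s <= x <= t -> U (c x).
  move=> xst; apply/rU/dr; rewrite ltr_norml; move: sd td; rewrite !ltr_norml; lra.
have [g [gphi gz gc]] := evenly_covered_section oU
  (ltac:(by rewrite zw; exact: cU) : U (phi z)) evU.
pose cl x : R := Num.max s (Num.min x t).
have clst x : s <= cl x <= t by rewrite /cl le_max lexx ge_max ge_min st lexx orbT.
have clid x : s <= x <= t -> cl x = x.
  by move=> /andP[sx xt]; rewrite /cl min_l// max_r.
have cl1 x x' : `|cl x - cl x'| <= `|x - x'| by exact: clamp_lip.
exists (fun x => g (c (cl x))); split.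
- apply/continuous_mdistP => x eps eps0.
  have [d1 d10 dg] := gc _ (cU _ (clst x)) eps eps0.
  move/continuous_mdistP: (cc) => /(_ (cl x) d1 d10)[d2 d20 dc].
  exists d2 => // x' xx'; have [] := dg (c (cl x')) => //.
  by apply: dc; exact: le_lt_trans (cl1 _ _) xx'.
- by move=> x xst; rewrite gphi ?clid//; exact: cU.
- by rewrite clid// -zw.
Qed.

(* [phi] need not shrink distances globally: the metric of [X'] is not assumed
   to be the path metric.  Hence the refinement of partitions. *)
Lemma curve_length_local_isometry (c : R -> X') : locally_isometric phi ->
  {within `[0, 1], continuous c} ->
  (curve_length (phi \o c) <= curve_length c)%E.
Proof.
move=> iso /within_mdistP cc.
have ref a b : 0 <= a -> a <= b -> b <= 1 -> exists s,
    [/\ path <%R a s, last a s = b & mdist (phi (c a)) (phi (c b)) <= polylen c a s].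
  move=> a0 ab b1; pose Q a b := exists s,
    [/\ path <%R a s, last a s = b & mdist (phi (c a)) (phi (c b)) <= polylen c a s].
  apply: (@segment_chain _ a b Q) => //.
    move=> u v w _ _ _ _ [s1 [p1 l1 m1]] [s2 [p2 l2 m2]]; exists (s1 ++ s2).
    rewrite cat_path p1 l1 p2 last_cat l1 l2 polylen_cat l1; split=> //.
    by have := metric_triangle (phi (c u)) (phi (c v)) (phi (c w)); lra.
  move=> u uab; have [N /nbhs_mdistP[r r0 rN] Niso] := iso (c u).
  have [d d0 dr] := cc u ltac:(by rewrite /= in_itv/=; lra) r r0.
  exists d => // s t as_ st tb us ut.
  have [->|st'] := eqVneq s t; first by exists [::]; rewrite mdistxx polylen_nil.
  exists [:: t]; rewrite /= andbT lt_neqAle st' st; split=> //.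
  rewrite polylen_cons polylen_nil addr0 Niso//;
    by apply: rN; apply: dr => //; rewrite /= in_itv/=; lra.
have refs s a : path <%R a s -> last a s <= 1 -> 0 <= a -> exists s',
    [/\ path <%R a s', last a s' = last a s &
      polylen (phi \o c) a s <= polylen c a s'].
  elim: s a => [|b s IH] a /=.
    by move=> _ _ _; exists [::]; rewrite !polylen_nil.
  move=> /andP[ab pb] l1 a0.
  have bl : b <= last b s.
    case: s pb {IH l1} => [//|x s] /(order_path_min lt_trans)/allP bs.
    by apply/ltW/bs; exact: (mem_last x s).
  have [s1 [p1 l1' m1]] := ref a b a0 (ltW ab) (le_trans bl l1).
  have [s2 [p2 l2 m2]] := IH b pb l1 (le_trans a0 (ltW ab)).
  exists (s1 ++ s2); rewrite cat_path p1 l1' p2 last_cat l1' l2; split=> //.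
  by rewrite polylen_cons polylen_cat l1'; exact: lerD.
apply: ge_ereal_sup => _ [s [ps /eqP ls] <-].
have [s' [ps' ls' le]] := refs s 0 ps ltac:(by rewrite ls) (lexx 0).
apply: (@le_trans _ _ (polylen c 0 s')%:E); first by rewrite lee_fin.
by apply: ereal_sup_ubound; exists s' => //; split=> //; apply/eqP; rewrite ls'.
Qed.

End CoveringMaps.

(** * The lifted model on the universal cover *)

Section CoveringGraph.
Context {R : realType} {X' X : metricType R} (phi : X' -> X) (V : set X).
Hypothesis phi_cov : universal_covering phi.
Hypothesis X_graph : metric_graph [set: X].
Hypothesis X_compact : compact [set: X].
Hypothesis V_vertex : vertex_set [set: X] V.

Lemma covering_open y (r : R) : 0 < r ->
  exists2 d, 0 < d & forall x, mdist (phi y) x < d -> exists2 z, mdist y z < r & phi z = x.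
Proof.
move=> r0; have [_ _ _ ev _] := phi_cov.
have [U [oU Uy evU]] := ev (phi y).
have [g [gphi gy gc]] := evenly_covered_section oU Uy evU.
have [d d0 dg] := gc _ Uy r r0; exists d => // x /dg[Ux]; rewrite gy => yg.
by exists (g x) => //; exact: gphi.
Qed.

Lemma covering_isometry y : exists2 r : R, 0 < r & forall a b,
  mdist y a < r -> mdist y b < r -> mdist (phi a) (phi b) = mdist a b.
Proof.
have [_ _ _ _ iso] := phi_cov; have [N /nbhs_mdistP[r r0 rN] Niso] := iso y.
by exists r => // a b /rN + /rN; exact: Niso.
Qed.

(** The lifted open edge is a whole component over the complement of [V]: it is open by [edge_open]
    and the local isometry, and relatively closed because its ends lie over [V]. Its path distance
    is at most the parameter distance since the lift is 1-Lipschitz, and at least that since [phi]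
    does not lengthen curves and maps them into [e]. *)
Lemma lift_oedge e y t : oedges [set: X] V e -> 0 < t < elen e ->
  phi y = epar e t -> exists2 e', lift_of phi V e e' & epar e' t = y.
Proof.
move=> eE tl phiy; have [l0 ce [es et] [Vs Vt] _] := eE.
have [c0 [c0c c0l c0t]] := path_lifting (a := 0) (b := elen e) (u := t) phi_cov ce
  ltac:(lra) phiy.
(* Clamping makes the lift constant beyond its ends, as [oedges] demands. *)
pose c s := c0 (Num.max 0 (Num.min s (elen e))).
have cl_in s : 0 <= Num.max 0 (Num.min s (elen e)) <= elen e.
  by rewrite le_max lexx ge_max ge_min lexx orbT (ltW l0).
have cc : continuous c.
  apply/continuous_mdistP => s eps eps0.
  move/continuous_mdistP: c0c => /(_ (Num.max 0 (Num.min s (elen e))) eps eps0)[d d0 dc].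
  by exists d => // u su; apply: dc; exact: le_lt_trans (clamp_lip _ _ _ _) su.
have ct : c t = y.
  by rewrite /c min_l ?max_r//; lra.
have phic : phi \o c = epar e.
  apply/funext => s /=; rewrite /c c0l//.
  have [s0|s0] := leP s 0.
    by rewrite min_l ?max_l ?es//; lra.
  have [sl|sl] := leP s (elen e); first by rewrite max_r// ltW.
  by rewrite max_r ?et//; lra.
have phicE s : phi (c s) = epar e s by rewrite -phic.
have c1 s u : 0 < s -> s <= u -> u < elen e -> mdist (c s) (c u) <= u - s.
  move=> s0 su ul.
  apply: (@segment_chain _ s u (fun s u => mdist (c s) (c u) <= u - s)) => //.
    by move=> a b d _ _ _ _ ab bd; have := metric_triangle (c s) (c u) (c u);
       have := metric_triangle (c a) (c b) (c d); lra.
  move=> a asu; have [r r0 rc] := covering_isometry (c a).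
  move/continuous_mdistP: cc => /(_ a r r0)[d d0 dc]; exists d => // p q sp pq qu ap aq.
  rewrite -rc; [|exact: dc|exact: dc].
  rewrite !phicE; have := path_isometry_lip (seg_int_iso eE) (s := p) (t := q).
  by rewrite distrC ger0_norm ?subr_ge0//; apply; lra.
have c1' s u : 0 < s < elen e -> 0 < u < elen e -> mdist (c s) (c u) <= `|s - u|.
  move=> sl ul; have [su|su] := leP s u.
    by rewrite distrC ger0_norm ?subr_ge0//; apply: c1; lra.
  by rewrite gtr0_norm ?subr_gt0// metric_sym; apply: c1; lra.
have cV s : 0 < s < elen e -> ([set: X'] `\` phi @^-1` V) (c s).
  move=> sl; split=> //; rewrite /preimage/= phicE.
  by have [] := seg_int_sub eE (seg_int_mem sl).
have img : c @` `]0, elen e[ = connected_component ([set: X'] `\` phi @^-1` V) y.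
  apply/seteqP; split.
    apply: connected_component_max.
    - by exists t; rewrite //= in_itv.
    - by move=> _ [s /= + <-]; rewrite in_itv/=; exact: cV.
    - apply: connected_continuous_connected; last exact: continuous_subspaceT.
      exact/connected_intervalP/interval_is_interval.
  apply: (connected_clopen (x := y)).
  - exact: component_connected.
  - by apply: connected_component_refl; rewrite -ct; exact: cV.
  - by exists t; rewrite //= in_itv.
  - move=> _ _ [s /= + <-]; rewrite in_itv/= => sl.
    have [r r0 rc] := covering_isometry (c s).
    move/continuous_mdistP: (cc) => /(_ s r r0)[d d0 dc].
    have [r2 r20 rE] := edge_open X_graph V_vertex eE sl d0.
    have [_ pc _ _ _] := phi_cov.
    have [r3 r30 rp] := continuous_mdist pc (c s) r20.
    exists (Num.min r r3); first by rewrite lt_min r0.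
    move=> z _; rewrite lt_min => /andP[zr zr3].
    have := rp z zr3; rewrite phicE => /rE[u [ul su zu]].
    exists u; rewrite /= ?in_itv//=; apply: mdist_positivity.
    by rewrite -rc//; [rewrite phicE zu mdistxx|exact: dc].
  - move=> z zC zS.
    have clK : closed (c @` `[0, elen e]).
      apply: compact_closed; first exact: metric_hausdorff.
      apply: continuous_compact; first exact: continuous_subspaceT.
      exact: segment_compact.
    have nK : ~ (c @` `[0, elen e]) z.
      move=> [s /=]; rewrite in_itv/= => sl sz.
      have [_ nVz] := connected_component_sub zC; apply: nVz; rewrite /preimage/= -sz phicE.
      have [s0|s0] := leP s 0; first by rewrite es.
      have [ls|ls] := leP (elen e) s; first by rewrite et.
      by exfalso; apply: zS; exists s; rewrite //= in_itv/= s0.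
    have : open (~` (c @` `[0, elen e])) by apply: closed_openC.
    rewrite openE => /(_ z nK)/nbhs_mdistP[r r0 rK]; exists r => // w _ /rK wK wS.
    by apply: wK; move: wS => [s /= + <-]; rewrite in_itv/= => sl; exists s; rewrite //= in_itv/=; lra.
have cC s : 0 < s < elen e -> connected_component ([set: X'] `\` phi @^-1` V) y (c s).
  by move=> sl; rewrite -img; exists s; rewrite //= in_itv.
exists (OSeg (elen e) c) => //; split=> //; split=> //=.
- rewrite /src /tgt /= /c; split=> s sl; congr c0.
    by rewrite !min_l ?max_l//; lra.
  by rewrite minxx min_r.
- by rewrite /src /tgt /preimage/= !phicE.
- exists y; first by rewrite -ct; exact: cV.
  split=> // s u sl ul; apply/eqP; rewrite eq_le; apply/andP; split.
    have [su|su] := leP s u.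
      rewrite distrC ger0_norm ?subr_ge0//; apply: path_dist_seg => //.
        by move=> a b asu bsu; apply: c1'; lra.
      by move=> a asu; apply: cC; lra.
    (* [path_dist_seg] wants increasing parameters, so this case runs [c] backwards. *)
    rewrite gtr0_norm ?subr_gt0// -{1}(opprK s) -{1}(opprK u).
    rewrite (_ : s - u = - u - (- s)); last ring.
    apply: (@path_dist_seg _ _ _ (fun x => c (- x))); first lra.
      move=> a b asu bsu; rewrite distrC (_ : b - a = - a - (- b)); last ring.
      by apply: c1'; lra.
    by move=> a asu; apply: cC; lra.
  apply: le_ereal_inf_tmp => _ [q [qc qC qs qu] <-].
  have [_ pc _ _ piso] := phi_cov.
  apply: le_trans (curve_length_local_isometry piso qc).
  have [_ <-] := seg_int_iso eE => //.
  apply: path_dist_le => /=.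
  - apply/within_mdistP => z zI eps eps0.
    have [d1 d10 pd] := continuous_mdist pc (q z) eps0.
    move/within_mdistP: qc => /(_ z zI d1 d10)[d d0 dq].
    by exists d => // w wI zw; apply/pd/dq.
  - move=> _ [z zI <-]/=; have : (q @` `[0, 1]) (q z) by exists z.
    by move=> /qC; rewrite -img => -[w /= + <-]; rewrite in_itv/= phicE => wl; exact: seg_int_mem.
  - by rewrite qs phicE.
  - by rewrite qu phicE.
Qed.

Lemma oedge_lift_exists e : oedges [set: X] V e -> exists e', lift_of phi V e e'.
Proof.
move=> eE; have [l0 _ _ _ _] := eE; have [_ _ sur _ _] := phi_cov.
have [y yE] := sur (epar e (elen e / 2)).
by have [e' e'l _] := lift_oedge eE (t := elen e / 2) ltac:(lra) yE; exists e'.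
Qed.

Lemma lift_of_bar e e' : lift_of phi V e e' -> lift_of phi V (bar e) (bar e').
Proof.
move=> [e'E ll phie]; split=> //; first exact: oedges_bar.
by apply/funext => t /=; rewrite -phie ll.
Qed.

Lemma covering_valence y n : has_valence [set: X'] y n -> has_valence [set: X] (phi y) n.
Proof.
move=> [r r0 /(star_nbhd_chart r0)[r' r'0 [f fr]]].
have [r1 r10 iso] := covering_isometry y.
pose r2 := Num.min r' r1.
have r20 : 0 < r2 by rewrite lt_min r'0.
have sf : star_chart [set: X'] y r2 f by apply: fr; rewrite r20 ge_min lexx.
have [d d0 dphi] := covering_open y r20.
have near_y k t : 0 <= t < r2 -> mdist y (f k t) < r1.
  by move=> tr; rewrite (star_mdist k sf)//; case/andP: tr => _ /lt_le_trans->//; rewrite ge_min lexx orbT.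
exists r2 => //; exists (fun k t => phi (f k t)); split.
- by move=> k; rewrite (star0 sf).
- by move=> k j s t sr tr; rewrite iso ?(star_dist sf)//; exact: near_y.
- by [].
exists [set x | mdist (phi y) x < d]; first by apply/nbhs_mdistP; exists d.
move=> x [/= /dphi[z yz <-] _].
have [->|[k [t [tr ->]]]] := star_cover sf I yz; first by left.
by right; exists k, t.
Qed.

(** [V] pulls back to isolated points because [phi] is locally injective, valences are preserved,
    and a point off the preimage lies on the lift of the edge below it. *)
Lemma covering_vertex_set : vertex_set [set: X'] (phi @^-1` V).
Proof.
have [_ Vi Vv _] := V_vertex; have [_ pc _ _ _] := phi_cov; split=> //.
- move=> y Vy; split; first by rewrite inE.
  have [_ [W /nbhs_mdistP[r r0 rW] WV]] := Vi _ Vy.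
  have [r1 r10 iso] := covering_isometry y.
  have [r2 r20 rp] := continuous_mdist pc y r0.
  exists [set z | mdist y z < Num.min r1 r2].
    by apply/nbhs_mdistP; exists (Num.min r1 r2); rewrite // lt_min r10.
  apply/seteqP; split=> [z [/=]|z -> /=]; last by rewrite mdistxx lt_min r10 r20.
  rewrite lt_min => /andP[z1 z2] Vz.
  have : (W `&` V) (phi z) by split=> //; apply/rW/rp.
  rewrite WV /= => zy; apply/esym/mdist_positivity; rewrite -iso ?zy ?mdistxx//.
- by move=> y n _ yn n2; apply: (Vv _ n) => //; exact: covering_valence.
- move=> y [_ nVy]; have [e eE ey] := component_oedge X_compact V_vertex nVy.
  have [t tl ty] := seg_intP ey.
  have [e' [e'E ll _] e't] := lift_oedge eE tl (esym ty).
  have l0 : 0 < elen e' by case: e'E.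
  exists (elen e'), (epar e'); split=> //.
  by rewrite -(seg_int_component e'E (x := y)) -?e't;
    [exact: seg_int_iso e'E|apply: seg_int_mem; rewrite ll].
Qed.

End CoveringGraph.

(** * Degree of loops on the circle *)

Section Joined.
Context {R : realType} {X : metricType R}.
Implicit Types (Y : set X) (x y z : X).

(** The curve lives on all of [R] with values in [Y], so gluing and affine reparametrisation need no
    restriction to an interval. *)
Definition joined Y x y : Prop :=
  exists c : R -> X, [/\ continuous c, c 0 = x, c 1 = y & forall t, Y (c t)].

Lemma continuous_affine (c : R -> X) (a b : R) : continuous c ->
  continuous (fun t => c (a * t + b)).
Proof.
move=> /continuous_mdistP cc; apply/continuous_mdistP => t eps eps0.
have [d d0 dc] := cc (a * t + b) eps eps0.
have a1 : 0 < `|a| + 1 by rewrite ltr_wpDl.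
exists (d / (`|a| + 1)); first by rewrite divr_gt0.
move=> s; rewrite ltr_pdivlMr// => ts; apply: dc.
rewrite opprD addrACA subrr addr0 -mulrBr normrM.
by apply: le_lt_trans ts; rewrite mulrC ler_wpM2l// lerDl.
Qed.

Lemma joined_refl Y x : Y x -> joined Y x x.
Proof. by move=> Yx; exists (fun=> x); split=> //; exact: cst_continuous. Qed.

Lemma joined_sym Y x y : joined Y x y -> joined Y y x.
Proof.
move=> [c [cc c0 c1 cY]]; exists (fun t => c (-1 * t + 1)); split=> //.
- exact: continuous_affine.
- by rewrite mulr0 add0r.
- by rewrite mulr1 addNr.
Qed.

Lemma joined_trans Y x y z : joined Y x y -> joined Y y z -> joined Y x z.
Proof.
move=> [c [cc c0 c1 cY]] [d [dc d0 d1 dY]].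
exists (fun t => if t <= 1 / 2 then c (2 * t + 0) else d (2 * t + (-1))); split.
- apply: glue_continuous; [exact: continuous_affine|exact: continuous_affine|].
  have -> : 2 * (1 / 2) + 0 = 1 :> R by lra.
  have -> : 2 * (1 / 2) + (-1) = 0 :> R by lra.
  by rewrite c1 d0.
- by rewrite mulr0 addr0 c0 divr_ge0.
- rewrite ifF; last by apply/negbTE; rewrite -ltNge; lra.
  by have -> : 2 * 1 + (-1) = 1 :> R by lra.
- by move=> t; case: ifP.
Qed.

Lemma joined_component Y x y : joined Y x y -> connected_component Y x y.
Proof.
move=> [c [cc c0 c1 cY]].
apply: (connected_component_max (B := c @` `[0, 1])).
- by exists 0; rewrite //= in_itv/=; lra.
- by move=> _ [t _ <-]; exact: cY.
- apply: connected_continuous_connected; first exact: segment_connected.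
  exact: continuous_subspaceT.
- by exists 1; rewrite //= in_itv/=; lra.
Qed.

Lemma joined_arm Y x n r (f : 'I_n -> R -> X) k t :
  star_chart [set: X] x r f -> 0 <= t < r ->
  (forall s, 0 <= s <= t -> Y (f k s)) -> joined Y x (f k t).
Proof.
move=> sf tr sY; exists (fun u => f k (t * Num.max 0 (Num.min u 1))).
have cl (u : R) : 0 <= Num.max 0 (Num.min u 1) <= 1.
  by rewrite le_max lexx ge_max ge_min lexx ler01 orbT.
have clr u : 0 <= t * Num.max 0 (Num.min u 1) <= t.
  by have := cl u; move: (Num.max _ _) => m ml; nra.
split.
- apply/continuous_subspace_setT/(lip_within (K := t)) => u v _ _.
  rewrite (star_dist sf) ?eqxx.
  + rewrite -mulrBr normrM ger0_norm; last by case/andP: tr.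
    by apply: ler_wpM2l; [case/andP: tr|exact: clamp_lip].
  + by have := clr u; lra.
  + by have := clr v; lra.
- by rewrite min_l ?max_l ?mulr0 ?(star0 sf).
- by rewrite minxx max_r ?mulr1.
- by move=> u; apply: sY.
Qed.

End Joined.

(** * Rounding differences modulo 1 *)

Section CircleFunction.
Context {R : realType}.

(** The representative of [x] modulo 1 in [[-1/2, 1/2[], that is, the signed short arc on the
    circle. *)
Definition cdiff (x : R) : R := x - (Num.floor (x + 1 / 2))%:~R.

Lemma cdiff_eq x (n : int) : `|x - n%:~R| < 1 / 2 -> cdiff x = x - n%:~R.
Proof.
rewrite ltr_norml => xn; rewrite /cdiff (@floor_def _ _ n)// intrD; lra.
Qed.

Lemma cdiff0 : cdiff 0 = 0.
Proof. by rewrite (@cdiff_eq _ 0) subrr// normr0; lra. Qed.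

(** Points of the circle are represented by real numbers, so a continuous map to the circle may jump
    by integers. *)
Definition circle_close (eps x y : R) : Prop := exists n : int, `|y - x - n%:~R| < eps.

Lemma circle_closeP eps x y : eps <= 1 / 2 -> circle_close eps x y ->
  `|cdiff (y - x)| < eps.
Proof. by move=> eps2 [n xy]; rewrite (@cdiff_eq _ n)//; lra. Qed.

Lemma cdiff_int x : exists n : int, x - cdiff x = n%:~R.
Proof. by exists (Num.floor (x + 1 / 2)); rewrite /cdiff opprB addrC subrK. Qed.

(** The two sides differ by an integer, and four terms below [1 / 8] make it smaller than 1 in
    absolute value. *)
Lemma cdiff_square (a b c d : R) :
  circle_close (1 / 8) a b -> circle_close (1 / 8) b d ->
  circle_close (1 / 8) a c -> circle_close (1 / 8) c d ->
  cdiff (b - a) + cdiff (d - b) = cdiff (c - a) + cdiff (d - c).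
Proof.
have e8 : 1 / 8 <= 1 / 2 :> R by lra.
move=> /(circle_closeP e8) ab /(circle_closeP e8) bd.
move=> /(circle_closeP e8) ac /(circle_closeP e8) cd.
have [n1 N1] := cdiff_int (b - a); have [n2 N2] := cdiff_int (d - b).
have [n3 N3] := cdiff_int (c - a); have [n4 N4] := cdiff_int (d - c).
have E : cdiff (b - a) + cdiff (d - b) - (cdiff (c - a) + cdiff (d - c)) =
    (n3 + n4 - n1 - n2)%:~R.
  by rewrite !(intrD, intrN) -N1 -N2 -N3 -N4; ring.
apply/eqP; rewrite -subr_eq0 E intr_eq0.
have : `|(n3 + n4 - n1 - n2)%:~R : R| < 1.
  by rewrite -E; move: ab bd ac cd; rewrite !ltr_norml; lra.
by rewrite -intr_norm (ltr_int _ _ 1) -[X in _ < X]add0r ltzD1 normr_le0.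
Qed.

(* Grid form of homotopy invariance of the degree of a loop on the circle. *)
Lemma grid_degree (N : nat) (a : nat -> nat -> R) :
  (forall i j, (i <= N)%N -> (j < N)%N -> circle_close (1 / 8) (a i j) (a i j.+1)) ->
  (forall i j, (i < N)%N -> (j <= N)%N -> circle_close (1 / 8) (a i j) (a i.+1 j)) ->
  (forall i, (i < N)%N -> a i.+1 0%N = a i 0%N /\ a i.+1 N = a i N) ->
  \sum_(j < N) cdiff (a 0%N j.+1 - a 0%N j) = \sum_(j < N) cdiff (a N j.+1 - a N j).
Proof.
move=> ch cv cb.
suff H i : (i <= N)%N ->
    \sum_(j < N) cdiff (a 0%N j.+1 - a 0%N j) = \sum_(j < N) cdiff (a i j.+1 - a i j).
  exact: H.
elim: i => // i IH iN; rewrite IH; last exact: ltnW.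
apply/eqP; rewrite -subr_eq0 -sumrB; apply/eqP.
(* By [cdiff_square] the difference of adjacent rows telescopes into vertical steps, and those at
   the two ends cancel because the end columns are constant. *)
have -> : \sum_(j < N) (cdiff (a i j.+1 - a i j) - cdiff (a i.+1 j.+1 - a i.+1 j)) =
  \sum_(0 <= j < N) (- cdiff (a i.+1 j.+1 - a i j.+1) - - cdiff (a i.+1 j - a i j)).
  rewrite big_mkord; apply: eq_bigr => j _.
  have := cdiff_square (ch i j (ltnW iN) (ltn_ord j)) (cv i j.+1 iN (ltn_ord j))
    (cv i j iN (ltnW (ltn_ord j))) (ch i.+1 j iN (ltn_ord j)).
  by lra.
rewrite telescope_sumr//; have [-> ->] := cb i iN.
by rewrite !subrr.
Qed.

(** A Lebesgue number for the unit square. *)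
Lemma square_uniform (P : R * R -> R * R -> Prop) :
  let K : set (R * R) := `[0, 1]%classic `*` `[0, 1]%classic in
  (forall p, K p -> exists2 d, 0 < d & forall q q', K q -> K q' ->
     ball p d q -> ball p d q' -> P q q') ->
  exists2 d, 0 < d & forall q q', K q -> K q' -> ball q d q' -> P q q'.
Proof.
move=> K loc; have cK : compact K by apply: compact_setX; exact: segment_compact.
have /compact_near_coveringP/(_ R (0^'+) (fun e q => K q -> forall q', K q' -> ball q e q' -> P q q')) := cK.
move=> /(_ _)[].
  move=> p Kp; have [d d0 dP] := loc p Kp.
  exists (ball p (d / 2), [set e | e < d / 2]) => /=.
    split; first by apply: nbhsx_ballx; rewrite divr_gt0.
    by apply: nbhs_right_lt; rewrite divr_gt0.
  move=> [q e]/= [pq ed] Kq q' Kq' qq'; apply: dP => //.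
    by apply: le_ball pq; lra.
  rewrite (splitr d); apply: ball_triangle pq _; apply: le_ball qq'; exact: ltW.
move=> e /= e0 eP; exists (e / 2); first by rewrite divr_gt0.
move=> q q' Kq Kq' qq'; apply: (eP (e / 2)) => //=.
- by rewrite sub0r normrN gtr0_norm ?divr_gt0// ltr_pdivrMr// ltr_pMr// ltr1n.
- by rewrite divr_gt0.
Qed.

End CircleFunction.

(** * Removing an edge from a tree *)

Section EdgeRemoval.
Context {R : realType} {X : metricType R} (V : set X) (e : oseg R X).
Hypothesis X_graph : metric_graph [set: X].
Hypothesis V_vertex : vertex_set [set: X] V.
Hypothesis eE : oedges [set: X] V e.

Let Y := ~` seg_int e.

Lemma vertex_off_seg x : V x -> Y x.
Proof. by move=> Vx /(seg_int_sub eE)[]. Qed.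

Lemma epar_out t : t <= 0 \/ elen e <= t -> V (epar e t).
Proof.
by have [_ _ [es et] [Vs Vt] _] := eE; case=> [/es ->|/et ->].
Qed.

Lemma closed_epar a b : closed (epar e @` `[a, b]).
Proof.
have [_ ce _ _ _] := eE.
apply: compact_closed; first exact: metric_hausdorff.
by apply: continuous_compact; [exact: continuous_subspaceT|exact: segment_compact].
Qed.

Lemma avoid_epar a b x : ~ (epar e @` `[a, b]) x ->
  exists2 r : R, 0 < r & forall y, mdist x y < r -> ~ (epar e @` `[a, b]) y.
Proof.
have := closed_openC (closed_epar (a := a) (b := b)).
by rewrite openE => /[apply] /nbhs_mdistP.
Qed.

(** If [y] is an end of [e], each punctured arm of a small star lies wholly in [e] or wholly off it;
    otherwise a small star misses [e]. So an arm containing a point of [Y] can be followed back to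
    [y] within [Y]. Components of [Y] thereby become path components. *)
Lemma local_joined y : Y y -> exists2 r : R, 0 < r &
  forall z, Y z -> mdist y z < r -> joined Y y z.
Proof.
move=> Yy.
have [n [r [f [sf fY]]]] : exists n (r : R) (f : 'I_n -> R -> X), star_chart [set: X] y r f /\
    forall k t, 0 <= t < r -> Y (f k t) -> forall s, 0 <= s <= t -> Y (f k s).
  have [[u /=]|Ky] := pselect ((epar e @` `[0, elen e]) y).
    rewrite in_itv/= => ul uy.
    have Vy : V y.
      rewrite -uy; apply: epar_out; have [u0|u0] := leP u 0; first by left.
      have [lu|lu] := leP (elen e) u; first by right.
      by exfalso; apply: Yy; rewrite -uy; apply: seg_int_mem; rewrite u0.
    have [_ Vi _ _] := V_vertex.
    have [n [r [f [_ sf pf]]]] := isolated_chart X_graph (Vi _ Vy) ltr01.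
    exists n, r, f; split=> // k t tr Yt s st.
    have [s0|s0] := leP s 0.
      by rewrite (_ : s = 0) ?(star0 sf)//; lra.
    by move=> es; apply: Yt; apply: (arm_in_edge sf pf eE _ es); lra.
  have [d d0 dK] := avoid_epar Ky.
  have [n [r [f [rd sf]]]] := metric_graph_chart X_graph (x := y) I d0.
  exists n, r, f; split=> // k t tr _ s st /seg_intP[u ul us].
  apply: (dK (f k s)); first by rewrite (star_mdist k sf); lra.
  by exists u; rewrite //= in_itv/=; lra.
exists r; first exact: star_gt0 sf.
move=> z Yz yz; have [->|[k [t [tr zE]]]] := star_cover sf I yz.
  exact: joined_refl.
rewrite zE; apply: (joined_arm sf tr) => s st.
by apply: (fY k t) => //; rewrite -zE.
Qed.

Lemma component_joined x y : connected_component Y x y -> joined Y x y.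
Proof.
move=> xy; have Yx : Y x by have := connected_component_sub (connected_component_sym xy).
apply: (connected_clopen (C := connected_component Y x) (x := x)) xy.
- exact: component_connected.
- exact: connected_component_refl.
- exact: joined_refl.
- move=> z /connected_component_sub Yz xz; have [r r0 rz] := local_joined Yz.
  by exists r => // w /connected_component_sub Yw zw; apply: joined_trans xz (rz w Yw zw).
- move=> z /connected_component_sub Yz xz; have [r r0 rz] := local_joined Yz.
  exists r => // w /connected_component_sub Yw zw xw; apply: xz.
  by apply: joined_trans xw _; apply/joined_sym/rz.
Qed.

(** The points that lie on [e] or can be joined in [Y] to one of its ends form a clopen set of the
    connected space [X]. *)
Lemma half_tree_cover y : Y y -> half_tree e y \/ half_tree (bar e) y.
Proof.
rewrite /half_tree seg_int_bar tgt_bar => Yy.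
have [l0 _ _ [Vs Vt] _] := eE.
have Ys := vertex_off_seg Vs; have Yt := vertex_off_seg Vt.
have [_ cX _] := X_graph.
pose P z := seg_int e z \/ joined Y (tgt e) z \/ joined Y (src e) z.
have : P y.
  have mid : seg_int e (epar e (elen e / 2)) by apply: seg_int_mem; lra.
  apply: (connected_clopen (C := [set: X]) (P := P) cX I (or_introl mid)) => // z _.
    have [ez _|Yz] := pselect (seg_int e z).
      have := seg_int_open X_graph V_vertex eE; rewrite openE => /(_ z ez)/nbhs_mdistP.
      by move=> [r r0 rE]; exists r => // w _ /rE; left.
    have [r r0 rz] := local_joined Yz.
    move=> Pz; exists r => // w _ zw.
    have [|Yw] := pselect (seg_int e w); first by left.
    right; case: Pz => // -[] h; [left|right]; apply: joined_trans h _; exact: rz.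
  move=> nPz; have Yz : Y z by move=> ez; apply: nPz; left.
  have Kz : ~ (epar e @` `[0, elen e]) z.
    move=> [u /=]; rewrite in_itv/= => ul uz; apply: nPz; have [_ _ [es et] _ _] := eE.
    have [u0|u0] := leP u 0; first by right; right; rewrite -uz es//; exact: joined_refl.
    have [lu|lu] := leP (elen e) u; first by right; left; rewrite -uz et//; exact: joined_refl.
    by left; rewrite -uz; apply: seg_int_mem; rewrite u0.
  have [r1 r10 rK] := avoid_epar Kz; have [r2 r20 rz] := local_joined Yz.
  exists (Num.min r1 r2); first by rewrite lt_min r10.
  move=> w _; rewrite lt_min => /andP[w1 w2].
  have Yw : Y w.
    by move=> /seg_intP[u ul uw]; apply: (rK w w1); exists u; rewrite //= in_itv/=; lra.
  case=> // Pw; apply: nPz; right; have zw := joined_sym (rz w Yw w2).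
  by case: Pw => h; [left|right]; apply: joined_trans h zw.
case=> [//|[h|h]]; [left|right]; exact: joined_component.
Qed.

(* The map of [X] to the circle [R/Z] that wraps [e] once around and collapses
   the complement. *)
Lemma circle_map : exists h : X -> R, [/\
  forall t, 0 < t < elen e -> h (epar e t) = t / elen e,
  forall y, Y y -> h y = 0 &
  forall y eps, 0 < eps -> exists2 r, 0 < r &
    forall z, mdist y z < r -> circle_close eps (h y) (h z)].
Proof.
have [l0 _ _ _ _] := eE.
(* Off the edge no parameter exists and [xget] returns its default 0, the base point of the
   circle. *)
pose h y := xget 0 [set t | 0 < t < elen e /\ epar e t = y] / elen e.
have hin t : 0 < t < elen e -> h (epar e t) = t / elen e.
  move=> tl; rewrite /h; congr (_ / _); case: xgetP => [u _ [ul ut]|].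
    exact: (edge_inj eE).
  by move=> /(_ t)[].
have hout y : Y y -> h y = 0.
  move=> Yy; rewrite /h; case: xgetP => [u _ [ul ut]|]; last by rewrite mul0r.
  by exfalso; apply: Yy; rewrite -ut; exact: seg_int_mem.
exists h; split=> // y eps eps0.
pose d := eps * elen e; have d0 : 0 < d by rewrite mulr_gt0.
have [/seg_intP[t tl <-]|Yy] := pselect (seg_int e y).
  have [r r0 rE] := edge_open X_graph V_vertex eE tl d0; exists r => // z /rE[u [ul tu ->]].
  exists 0; rewrite subr0 !hin// -mulrBl normrM (gtr0_norm (_ : 0 < (elen e)^-1)) ?invr_gt0//.
  by rewrite ltr_pdivrMr// distrC.
(* Points near [y] avoid the middle of [e]. If they lie on [e], their parameter is within [d] of one
   of the ends; near the far end [h] is close to 1, hence close to 0 on the circle. *)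
have Ky : ~ (epar e @` `[d, elen e - d]) y.
  move=> [u /=]; rewrite in_itv/= => ul uy; apply: Yy; rewrite -uy; apply: seg_int_mem; lra.
have [r r0 rK] := avoid_epar Ky; exists r => // z /rK zK.
rewrite (hout y Yy) /circle_close.
have [/seg_intP[u ul uz]|Yz] := pselect (seg_int e z); last first.
  by exists 0; rewrite hout// !subrr normr0.
have ud : u < d \/ elen e - d < u.
  have [du|] := leP d u; last by left.
  right; rewrite ltNge; apply/negP => ud; apply: zK; exists u => //=.
  by rewrite in_itv/= du.
have [u0 u1] := andP ul.
rewrite -uz hin//; case: ud => ud.
  exists 0; rewrite !subr0 gtr0_norm ?divr_gt0// ltr_pdivrMr//.
exists 1; rewrite subr0 distrC ger0_norm; last first.
  by rewrite subr_ge0 ler_pdivrMr// mul1r ltW.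
rewrite -(ltr_pM2r l0) mulrBl divfK ?gt_eqF// mul1r -/d; lra.
Qed.

Lemma half_tree_disjoint : simply_connected (R := R) X ->
  forall y, half_tree e y -> half_tree (bar e) y -> False.
Proof.
move=> [_ _ sc] y; rewrite /half_tree seg_int_bar tgt_bar => ty sy.
have [l0 ce _ [Vs Vt] _] := eE.
have [g [gc g0 g1 gY]] : joined Y (tgt e) (src e).
  by apply/component_joined/(connected_component_trans ty)/connected_component_sym.
pose c t := if t <= 1 / 2 then epar e (2 * elen e * t + 0) else g (2 * t + (-1)).
have cc : continuous c.
  apply: glue_continuous; [exact: continuous_affine|exact: continuous_affine|].
  rewrite (_ : 2 * elen e * (1 / 2) + 0 = elen e); last by field.
  by rewrite (_ : 2 * (1 / 2) + (-1) = 0) ?g0//; lra.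
have c0 : c 0 = src e by rewrite /c mulr0 addr0 divr_ge0.
have c1 : c 1 = src e.
  rewrite /c ifF; last by apply/negbTE; rewrite -ltNge; lra.
  by rewrite (_ : 2 * 1 + (-1) = 1) ?g1//; lra.
have [H [Hc H0 H1 Hs]] := sc c ltac:(exact: continuous_subspaceT) ltac:(by rewrite c0 c1).
have [h [hin hout hc]] := circle_map.
have [d d0 dP] : exists2 d : R, 0 < d & forall q q' : R * R,
    (`[0, 1]%classic `*` `[0, 1]%classic) q -> (`[0, 1]%classic `*` `[0, 1]%classic) q' ->
    ball q d q' -> circle_close (1 / 8) (h (H q)) (h (H q')).
  apply: square_uniform => p Kp.
  (* Two points within [1 / 16] of a common value are within the [1 / 8] required by
     [grid_degree]. *)
  have [r r0 rh] := hc (H p) (1 / 16) ltac:(lra).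
  move/subspace_continuousP: Hc => /(_ p Kp)/cvg_ballP/(_ _ r0).
  rewrite near_withinE => /nbhs_ballP[d d0 dH]; exists d => // q q' Kq Kq' pq pq'.
  have := dH q pq Kq; have := dH q' pq' Kq'; rewrite !ballEmdist /= => /rh[m hm] /rh[n hn].
  exists (m - n); rewrite intrB; move: hm hn; rewrite !ltr_norml; lra.
(* [N] is even so that the switch from [e] to [g] at time [1 / 2] is a grid point; [M >= 3] makes a
   step [1 / M] shorter than [1 / 2], so that [cdiff] returns it unchanged. *)
pose M := (Num.bound d^-1).+3; pose N := (M + M)%N.
have M0 : 0 < M%:R :> R by rewrite ltr0n.
have N0 : 0 < N%:R :> R by rewrite ltr0n.
have Md : N%:R^-1 < d.
  have : d^-1 < (Num.bound d^-1)%:R by apply: archi_boundP; rewrite invr_ge0 ltW.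
  move=> H2; rewrite -[X in X < _]mul1r ltr_pdivrMr// -ltr_pdivrMl// mulr1.
  apply: lt_le_trans H2 _; rewrite ler_nat /N; apply: leq_trans (leq_addr _ _).
  by rewrite /M; do 3! apply: leqW.
pose pt i := i%:R / N%:R : R.
pose a i j := h (H (pt i, pt j)).
have pt0 : pt 0%N = 0 by rewrite /pt mul0r.
have ptN : pt N = 1 by rewrite /pt divff// gt_eqF.
have pt01 i : (i <= N)%N -> 0 <= pt i <= 1.
  by move=> iN; rewrite /pt divr_ge0//= ler_pdivrMr// mul1r ler_nat.
have ptS i : `|pt i - pt i.+1| < d.
  by rewrite /pt -mulrBl -natr1 opprD addNKr normrM normrN normr1 mul1r gtr0_norm ?invr_gt0.
have ptb i : `|pt i - pt i| < d by rewrite subrr normr0.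
have deg : \sum_(j < N) cdiff (a 0%N j.+1 - a 0%N j) = \sum_(j < N) cdiff (a N j.+1 - a N j).
  apply: grid_degree.
  - move=> i j iN jN; apply: dP.
    + by split; rewrite /= in_itv/=; apply: pt01 => //; exact: ltnW.
    + by split; rewrite /= in_itv/=; apply: pt01.
    + by split; [exact: ptb|exact: ptS].
  - move=> i j iN jN; apply: dP.
    + by split; rewrite /= in_itv/=; apply: pt01 => //; exact: ltnW.
    + by split; rewrite /= in_itv/=; apply: pt01.
    + by split; [exact: ptS|exact: ptb].
  - move=> i iN; rewrite /a pt0 ptN.
    have [-> ->] := Hs (pt i) (pt01 i (ltnW iN)).
    by have [-> ->] := Hs (pt i.+1) (pt01 _ iN).
have degN : \sum_(j < N) cdiff (a N j.+1 - a N j) = 0.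
  apply: big1 => j _; rewrite /a ptN.
  by rewrite !H1 ?subrr ?cdiff0//; apply: pt01 => //; exact: ltnW.
have ptM j : pt j <= 1 / 2 -> 2 * elen e * pt j = elen e * (j%:R / M%:R).
  by move=> _; rewrite /pt /N natrD; field; rewrite ?gt_eqF//; lra.
have a_lo j : (0 < j < M)%N -> a 0%N j = j%:R / M%:R.
  move=> /andP[j0 jM]; rewrite /a pt0 H0; last first.
    by apply: pt01; rewrite (leq_trans (ltnW jM))// leq_addr.
  have jp : pt j <= 1 / 2.
    by rewrite /pt ler_pdivrMr// /N natrD; have : j%:R <= M%:R :> R by [rewrite ler_nat ltnW|]; lra.
  rewrite /c jp addr0 ptM// hin; last first.
    by rewrite pmulr_rgt0// divr_gt0 ?ltr0n//= gtr_pMr// ltr_pdivrMr// mul1r ltr_nat.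
  by rewrite mulrAC divff ?mul1r// gt_eqF.
have a_0 : a 0%N 0%N = 0.
  by rewrite /a pt0 H0 ?lexx ?ler01// c0; apply/hout/vertex_off_seg.
have a_hi j : (M <= j <= N)%N -> a 0%N j = 0.
  move=> /andP[jM jN]; rewrite /a pt0 H0; last exact: pt01.
  rewrite /c; case: leP => jp; last exact/hout/gY.
  have -> : 2 * elen e * pt j + 0 = elen e * (j%:R / M%:R) by rewrite addr0 ptM.
  apply/hout/vertex_off_seg/epar_out; right.
  by rewrite ler_pMr// ler_pdivlMr// mul1r ler_nat.
have M3 : 3 <= M%:R :> R by rewrite ler_nat.
have iM : M%:R^-1 * 3 <= 1 :> R by rewrite mulrC ler_pdivrMr// mul1r.
have iM0 : 0 < M%:R^-1 :> R by rewrite invr_gt0.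
have : \sum_(j < N) cdiff (a 0%N j.+1 - a 0%N j) = 1.
  rewrite -(big_mkord xpredT (fun j => cdiff (a 0%N j.+1 - a 0%N j))).
  rewrite (@big_cat_nat _ _ _ M)//=; last exact: leq_addr.
  rewrite [X in _ + X]big_nat_cond [X in _ + X]big1 ?addr0; last first.
    move=> j; rewrite andbT => /andP[Mj jN].
    by rewrite !a_hi ?subrr ?cdiff0// ?Mj ?jN ?(leq_trans Mj)//= ltnW.
  have -> : \sum_(0 <= j < M) cdiff (a 0%N j.+1 - a 0%N j) = \sum_(0 <= j < M) M%:R^-1.
    rewrite big_nat_cond [RHS]big_nat_cond; apply: eq_bigr => j; rewrite andbT /= => jM.
    have [j0|j0] := posnP j.
      rewrite j0 a_0 a_lo// mul1r subr0.
      by rewrite (@cdiff_eq _ _ 0) subr0// gtr0_norm//; lra.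
    have [jM1|jM1] := ltnP j.+1 M.
      rewrite !a_lo ?j0// -mulrBl -natr1 addrAC subrr add0r mul1r.
      by rewrite (@cdiff_eq _ _ 0) subr0// gtr0_norm//; lra.
    (* At the end of [e] the value drops from [(M - 1) / M] to 0 instead of rising to 1; modulo 1
       this is still a step of [1 / M]. The [M] equal steps add up to 1. *)
    have jM' : j.+1 = M by apply/eqP; rewrite eqn_leq jM.
    rewrite a_hi ?a_lo ?j0 ?jM1 ?jM' ?leqnn ?leq_addr// sub0r.
    have -> : - (j%:R / M%:R) = M%:R^-1 - 1 :> R.
      have -> : j%:R = M%:R - 1 :> R by rewrite -jM' -natr1 addrK.
      by rewrite mulrBl divff ?gt_eqF// mul1r opprB.
    by rewrite (@cdiff_eq _ _ (-1)) intrN opprK subrK// gtr0_norm//; lra.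
  by rewrite sumr_const_nat subn0 -[LHS]mulr_natr mulVf// gt_eqF.
by rewrite deg degN => /esym/eqP; rewrite oner_eq0.
Qed.

End EdgeRemoval.

(** * Energies and projections *)

Section NonnegativeSums.
Context {R : realType} {I : choiceType}.
Implicit Types (D : set I) (F G : I -> R).

Lemma esumZ D F (k : R) : 0 < k -> (forall i, D i -> 0 <= F i) ->
  (\esum_(i in D) (k * F i)%:E = k%:E * \esum_(i in D) (F i)%:E)%E.
Proof.
have H (k' : R) G : 0 < k' -> (forall i, D i -> 0 <= G i) ->
    (\esum_(i in D) (k' * G i)%:E <= k'%:E * \esum_(i in D) (G i)%:E)%E.
  move=> k0 G0; apply: ge_ereal_sup => _ [A [finA AD] <-].
  rewrite (_ : (\sum_(i \in A) _)%E = (k'%:E * \sum_(i \in A) (G i)%:E)%E); last first.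
    by rewrite !fsumEFin// -EFinM !fsbig_finite//= big_distrr.
  by rewrite lee_pmul2l//; apply: ereal_sup_ubound; exists A.
move=> k0 F0; apply/eqP; rewrite eq_le H//=.
have := H k^-1 (fun i => k * F i); rewrite invr_gt0 k0 => /(_ isT).
rewrite (_ : (fun i => (k^-1 * (k * F i))%:E) = (fun i => (F i)%:E)); last first.
  by apply/funext => i; rewrite mulrA mulVf ?mul1r// gt_eqF.
move=> /(_ (fun i Di => mulr_ge0 (ltW k0) (F0 i Di))) H1.
have := @lee_wpmul2l _ k%:E ltac:(by rewrite lee_fin ltW) _ _ H1.
by rewrite muleA -EFinM divff ?mul1e// gt_eqF.
Qed.

Lemma esum_single D F i0 : D i0 -> 0 <= F i0 ->
  (forall i, D i -> i <> i0 -> F i = 0) -> (\esum_(i in D) (F i)%:E = (F i0)%:E)%E.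
Proof.
move=> Di0 F0 Fz.
rewrite (esumID [set i0]); last first.
  move=> i Di; rewrite lee_fin; have [->//|/eqP ii0] := eqVneq i i0.
  by rewrite Fz.
rewrite (_ : D `&` [set i0] = [set i0]); last by apply/setIidr => _ ->.
rewrite esum_set1 ?lee_fin// [X in (_ + X)%E]esum1 ?adde0//.
by move=> i [Di ii0]; rewrite Fz.
Qed.

Lemma esum_disjointU (D1 D2 : set I) F : (forall i, D1 i -> D2 i -> False) ->
  (forall i, D1 i \/ D2 i -> 0 <= F i) ->
  (\esum_(i in D1 `|` D2) (F i)%:E =
   \esum_(i in D1) (F i)%:E + \esum_(i in D2) (F i)%:E)%E.
Proof.
move=> disj F0; rewrite (esumID D1); last by move=> i Di; rewrite lee_fin; exact: F0.
congr (_ + _)%E; congr esum; apply/seteqP; split=> i /=.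
- by case.
- by move=> Di; split=> //; left.
- by move=> [[]].
- by move=> Di; split; [right|move=> Di1; exact: disj Di1 Di].
Qed.

End NonnegativeSums.

Section Energy.
Context {R : realType} {X : metricType R}.
Implicit Types (O : set (oseg R X)) (u w p : oseg R X -> R) (e : oseg R X).

(** Positive and negative parts are not additive in the integrand. Allowing any summable
    decomposition into nonnegative terms replaces linearity of the pairing. *)
Lemma pairingE O u w (A B : oseg R X -> R) :
  (forall e, O e -> 0 <= A e) -> (forall e, O e -> 0 <= B e) ->
  (\esum_(e in O) (A e)%:E < +oo)%E -> (\esum_(e in O) (B e)%:E < +oo)%E ->
  (forall e, O e -> rate u e * rate w e * elen e = A e - B e) ->
  (pairing O u w = \esum_(e in O) (A e)%:E - \esum_(e in O) (B e)%:E)%E.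
Proof.
move=> A0 B0 Af Bf AB.
have S (F : oseg R X -> R) : (forall e, O e -> 0 <= F e) ->
    (\esum_(e in O) (F e)%:E < +oo)%E -> summable O (fun e => (F e)%:E).
  move=> F0 Ff; rewrite summableE (@eq_esum _ _ _ _ (fun e => (F e)%:E)).
    by rewrite ge0_fin_numE// esum_ge0// => e Oe; rewrite lee_fin F0.
  by move=> e Oe; rewrite gee0_abs// lee_fin F0.
rewrite -(esumB (S A A0 Af) (S B B0 Bf)); last 2 first.
- by move=> e Oe; rewrite lee_fin A0.
- by move=> e Oe; rewrite lee_fin B0.
rewrite /pairing; congr (_ - _)%E; apply: eq_esum => e Oe;
  by rewrite ?funeposE ?funenegE /= AB// -EFin_max.
Qed.

Lemma sqnormE O w : (forall e, O e -> 0 < elen e) ->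
  sqnorm O w = (\esum_(e in O) (rate w e ^+ 2 * elen e)%:E)%E.
Proof.
move=> O0; have nn e : O e -> 0 <= rate w e * rate w e * elen e.
  by move=> Oe; rewrite mulr_ge0 ?(ltW (O0 e Oe))// -expr2 sqr_ge0.
rewrite /sqnorm /pairing [X in (_ - X)%E]esum1 ?sube0.
  by apply: eq_esum => e Oe; rewrite max_l ?nn// expr2.
by move=> e Oe; rewrite max_r// oppr_le0 nn.
Qed.

Lemma sqnorm_ge0 O w : (forall e, O e -> 0 < elen e) -> (0 <= sqnorm O w)%E.
Proof.
move=> O0; rewrite sqnormE//; apply: esum_ge0 => e Oe.
by rewrite lee_fin mulr_ge0 ?sqr_ge0// ltW// O0.
Qed.

Context (O : set (oseg R X)) (e0 : oseg R X) (p : oseg R X -> R).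
Hypothesis O_pos : forall e, O e -> 0 < elen e.
Hypothesis Oe0 : O e0.
Hypothesis Obar : ~ O (bar e0).
Hypothesis p_fin : (sqnorm O p < +oo)%E.
Hypothesis p_ge0 : 0 <= rate p e0.

Lemma rate_dform : rate (dform e0) e0 = 1.
Proof. by rewrite /rate /dform eqxx divff// gt_eqF// O_pos. Qed.

Lemma rate_dform0 e : O e -> e <> e0 -> rate (dform e0) e = 0.
Proof.
move=> Oe /eqP/negbTE ee0; rewrite /rate /dform ee0 ifN ?mul0r//.
by apply/eqP => eb; apply: Obar; rewrite -eb.
Qed.

Lemma rateB (u w : oseg R X -> R) e : rate (fun e => u e - w e) e = rate u e - rate w e.
Proof. exact: mulrBl. Qed.

Lemma projection_energy :
  pairing O (fun e => dform e0 e - p e) p = 0%E ->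
  sqnorm O p = (rate p e0 * elen e0)%:E.
Proof.
pose A e := rate (dform e0) e * rate p e * elen e.
have EA : (\esum_(e in O) (A e)%:E = (rate p e0 * elen e0)%:E)%E.
  rewrite (@esum_single _ _ _ _ e0) /A ?rate_dform ?mul1r//.
    by rewrite mulr_ge0// ltW// O_pos.
  by move=> e Oe ee0; rewrite rate_dform0// !mul0r.
rewrite (@pairingE _ _ _ A (fun e => rate p e ^+ 2 * elen e)).
- rewrite EA -sqnormE// => /eqP; rewrite sube_eq ?add0e//.
  by move=> /eqP.
- move=> e Oe; have [->|/eqP ee0] := eqVneq e e0.
    by rewrite /A rate_dform mul1r mulr_ge0// ltW// O_pos.
  by rewrite /A rate_dform0// !mul0r.
- by move=> e Oe; rewrite mulr_ge0 ?sqr_ge0// ltW// O_pos.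
- by rewrite EA ltry.
- by rewrite -sqnormE.
- by move=> e Oe; rewrite rateB /A; ring.
Qed.

(** Cauchy-Schwarz with a free parameter. With [c = rate p e0], [l = elen e0] and [|p|^2 = c l], one
    gets [l <= t c l / 2 + N / (2 t)] for all [t > 0]; the choice [t = 1 / c] gives
    [l <= l / 2 + c N / 2]. *)
Lemma projection_bound (w : oseg R X -> R) (N : R) :
  pairing O (fun e => dform e0 e - p e) p = 0%E ->
  pairing O (fun e => dform e0 e - p e) w = 0%E ->
  rate w e0 = 1 -> sqnorm O w = N%:E -> elen e0 <= rate p e0 * N.
Proof.
move=> pp pw w1 wN; have pE := projection_energy pp.
have l0 := O_pos Oe0.
(* [A - B] is the integrand of [pw] since
   [- x y = (t x - y)^2 / (2 t) - (t x^2 / 2 + y^2 / (2 t))]. *)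
have key t : 0 < t -> elen e0 <= t / 2 * (rate p e0 * elen e0) + N / (2 * t).
  move=> t0; have t20 : 0 < t / 2 by rewrite divr_gt0.
  have it0 : 0 < (2 * t)^-1 by rewrite invr_gt0 mulr_gt0.
  pose P e := rate p e ^+ 2 * elen e; pose W e := rate w e ^+ 2 * elen e.
  pose B e := t / 2 * P e + (2 * t)^-1 * W e.
  pose A1 e := rate (dform e0) e * rate w e * elen e.
  pose A2 e := (t * rate p e - rate w e) ^+ 2 / (2 * t) * elen e.
  have P0 e : O e -> 0 <= P e by move=> /O_pos/ltW le; rewrite mulr_ge0 ?sqr_ge0.
  have W0 e : O e -> 0 <= W e by move=> /O_pos/ltW le; rewrite mulr_ge0 ?sqr_ge0.
  have EB : (\esum_(e in O) (B e)%:E = (t / 2 * (rate p e0 * elen e0) + N / (2 * t))%:E)%E.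
    rewrite /B (@eq_esum _ _ _ _ (fun e => (t / 2 * P e)%:E + ((2 * t)^-1 * W e)%:E)%E)//.
    rewrite esumD; last 2 first.
    - by move=> e Oe; rewrite lee_fin mulr_ge0 ?P0// ltW.
    - by move=> e Oe; rewrite lee_fin mulr_ge0 ?W0// ltW.
    by rewrite !esumZ// /P /W -!sqnormE// pE wN -!EFinM -EFinD (mulrC N).
  have A10 e : O e -> 0 <= A1 e.
    move=> Oe; rewrite /A1; have [->|/eqP ee0] := eqVneq e e0.
      by rewrite rate_dform w1 !mul1r ltW.
    by rewrite rate_dform0// !mul0r.
  have A20 e : O e -> 0 <= A2 e.
    move=> /O_pos/ltW le; apply: mulr_ge0 => //.
    by apply: mulr_ge0; [exact: sqr_ge0|exact: ltW].
  have EA1 : (\esum_(e in O) (A1 e)%:E = (elen e0)%:E)%E.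
    rewrite (@esum_single _ _ _ _ e0)//; first by rewrite /A1 rate_dform w1 !mul1r.
      exact: A10.
    by move=> e Oe ee0; rewrite /A1 rate_dform0// !mul0r.
  have A2B e : O e -> A2 e <= 2 * B e.
    move=> Oe; rewrite /A2 /B /P /W -subr_ge0.
    rewrite (_ : _ - _ = (t * rate p e + rate w e) ^+ 2 / (2 * t) * elen e).
      apply: mulr_ge0; last exact/ltW/O_pos.
      by apply: mulr_ge0; [exact: sqr_ge0|exact: ltW].
    by field; rewrite gt_eqF.
  have B0 e : O e -> 0 <= B e.
    by move=> Oe; rewrite addr_ge0// mulr_ge0 ?P0 ?W0// ltW.
  have EA2 : (\esum_(e in O) (A2 e)%:E < +oo)%E.
    apply: (@le_lt_trans _ _ (\esum_(e in O) (2 * B e)%:E)%E).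
      by apply: le_esum => e Oe; rewrite lee_fin A2B.
    by rewrite esumZ// EB -EFinM ltry.
  have EA : (\esum_(e in O) (A1 e + A2 e)%:E =
      (elen e0)%:E + \esum_(e in O) (A2 e)%:E)%E.
    by rewrite -EA1 -esumD// => e Oe; rewrite lee_fin ?A10 ?A20.
  have A2ge : (0 <= \esum_(e in O) (A2 e)%:E)%E.
    by apply: esum_ge0 => e Oe; rewrite lee_fin A20.
  have AB e : O e ->
      rate (fun e => dform e0 e - p e) e * rate w e * elen e = A1 e + A2 e - B e.
    by move=> Oe; rewrite rateB /A1 /A2 /B /P /W; field; rewrite gt_eqF.
  have A0 e : O e -> 0 <= A1 e + A2 e by move=> Oe; rewrite addr_ge0 ?A10 ?A20.
  have := pairingE A0 B0 _ _ AB; rewrite pw EA EB lte_add_pinfty ?ltry//.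
  move=> /(_ isT isT).
  move: (t / 2 * _ + _) => b.
  have : (\esum_(e in O) (A2 e)%:E \is a fin_num)%E by rewrite ge0_fin_numE.
  move: A2ge; case: (\esum_(e in O) (A2 e)%:E)%E => [a| |]//.
  rewrite lee_fin => a0 _ E; have {}E : 0 = elen e0 + a - b by exact: EFin_inj E.
  lra.
(* For [c = 0] the bound reads [l <= N / (2 t)], which [t = (N + 1) / l] contradicts. *)
have [c0|c0] := eqVneq (rate p e0) 0.
  have N0 : 0 <= N by rewrite -lee_fin -wN sqnorm_ge0.
  have := key ((N + 1) / elen e0) ltac:(by rewrite divr_gt0// ltr_wpDl).
  rewrite c0 mul0r mulr0 add0r invfM mulrA invf_div mulrA.
  rewrite ler_pdivlMr; last by rewrite ltr_wpDl.
  move=> H; exfalso.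
  have : N / 2 * elen e0 < elen e0 * (N + 1) by rewrite mulrC ltr_pM2l//; lra.
  lra.
have cp : 0 < rate p e0 by rewrite lt_neqAle eq_sym c0.
have := key (rate p e0)^-1 ltac:(by rewrite invr_gt0).
rewrite (_ : _ + _ = elen e0 / 2 + rate p e0 * N / 2); first lra.
by field.
Qed.

End Energy.

(** * The model induced on a half tree *)

Section HalfTree.
Context {R : realType} {X : metricType R} (V : set X).
Hypothesis X_graph : metric_graph [set: X].
Hypothesis V_vertex : vertex_set [set: X] V.
Implicit Types (e f : oseg R X).

Lemma half_tree_off e : half_tree e `<=` ~` seg_int e.
Proof. exact: connected_component_sub. Qed.

Lemma tgt_half_tree e : oedges [set: X] V e -> half_tree e (tgt e).
Proof.
move=> eE; have [_ _ _ [_ Vt] _] := eE.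
by apply: connected_component_refl; exact: (vertex_off_seg eE Vt).
Qed.

Lemma connected_half_tree e (C : set X) x : connected C -> C `<=` ~` seg_int e ->
  C x -> half_tree e x -> C `<=` half_tree e.
Proof.
move=> cC CY Cx /same_connected_component; rewrite /half_tree => ->.
exact: connected_component_max.
Qed.

Lemma component_half_tree e x : oedges [set: X] V e -> half_tree e x -> ~ V x ->
  connected_component ([set: X] `\` V) x `<=` half_tree e.
Proof.
move=> eE Tx nVx; apply: (connected_half_tree (x := x)) => //.
- exact: component_connected.
- move=> z xz ez; apply: (half_tree_off Tx); rewrite (seg_int_component eE ez).
  exact: connected_component_sym.
- exact: connected_component_refl.
Qed.

Lemma half_tree_component e x : oedges [set: X] V e -> half_tree e x -> ~ V x ->
  connected_component (half_tree e `\` (V `&` half_tree e)) x =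
  connected_component ([set: X] `\` V) x.
Proof.
move=> eE Tx nVx; apply/seteqP; split.
  apply: connected_component_max.
  - by apply: connected_component_refl; split=> // -[].
  - by move=> z /connected_component_sub[Tz nVz]; split=> // Vz; exact: nVz.
  - exact: component_connected.
apply: connected_component_max.
- exact: connected_component_refl.
- move=> z xz; split; first exact: (component_half_tree eE Tx nVx).
  by have [_ nVz] := connected_component_sub xz; move=> -[].
- exact: component_connected.
Qed.

(** The delicate point is valence: removing [e] may change it at the ends of [e], but those are
    vertices. Elsewhere the half tree contains a neighbourhood of its point, so a star in it is a
    star in [X]. The induced model thus qualifies as a witness of [transient]. *)
Lemma half_tree_vertex_set e : oedges [set: X] V e ->
  vertex_set (half_tree e) (V `&` half_tree e).
Proof.
move=> eE; have [_ Vi Vv Vc] := V_vertex; split.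
- by move=> x [].
- move=> x [Vx Tx]; have [_ [W Wx WV]] := Vi _ Vx.
  split; first by rewrite inE.
  exists W => //; apply/seteqP; split=> [y [Wy [Vy _]]|y ->].
    by rewrite -WV.
  by split; [exact: nbhs_singleton|].
- move=> x n Tx [r r0 /(star_nbhd_chart r0)[r' r'0 [f fr]]] n2; split=> //.
  apply: contrapT => nVx; apply: (nVx); apply: (Vv _ n) => //.
  have Kx : ~ (epar e @` `[0, elen e]) x.
    move=> [u /=]; rewrite in_itv/= => ul ux.
    have [u0|u0] := leP u 0; first by apply: nVx; rewrite -ux; apply: (epar_out eE); left.
    have [lu|lu] := leP (elen e) u; first by apply: nVx; rewrite -ux; apply: (epar_out eE); right.
    by apply: (half_tree_off Tx); rewrite -ux; apply: seg_int_mem; rewrite u0.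
  have [d d0 dK] := avoid_epar eE Kx.
  have [d' d'0 dj] := local_joined X_graph V_vertex eE (half_tree_off Tx).
  pose r1 := Num.min r' (Num.min d d').
  have r10 : 0 < r1 by rewrite !lt_min r'0 d0.
  have sf : star_chart (half_tree e) x r1 f by apply: fr; rewrite r10 ge_min lexx.
  suff sf' : star_chart [set: X] x r1 f by exact: chart_valence sf'.
  case: sf => [? ? ? _ _ fc]; split=> // y _ xy; apply: fc => //.
  move: (xy); rewrite !lt_min => /and3P[_ yd yd'].
  apply: connected_component_trans Tx _; apply: joined_component; apply: dj => //.
  by move=> /seg_intP[u ul uy]; apply: (dK y yd); exists u; rewrite //= in_itv/=; lra.
- move=> x [Tx nVTx]; have nVx : ~ V x by move=> Vx; apply: nVTx.
  by rewrite half_tree_component//; apply: Vc.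
Qed.

End HalfTree.

Section HalfTreeEdges.
Context {R : realType} {X : metricType R} (V : set X).
Hypothesis X_graph : metric_graph [set: X].
Hypothesis V_vertex : vertex_set [set: X] V.
Implicit Types (e f : oseg R X) (O : set (oseg R X)) (w : oseg R X -> R).

Definition half_edges e := oedges (half_tree e) (V `&` half_tree e).

Lemma edge_connected A e : oedges A V e -> connected (seg_int e).
Proof. by move=> [_ _ _ _ [x _ [Ex _]]]; rewrite /seg_int Ex; exact: component_connected. Qed.

Lemma edge_mid A e : oedges A V e -> seg_int e (epar e (elen e / 2)).
Proof. by move=> [l0 _ _ _ _]; apply: seg_int_mem; lra. Qed.

Lemma closed_edge_half_tree e f : oedges [set: X] V e -> oedges [set: X] V f ->
  seg_int f `<=` half_tree e -> epar f @` `[0, elen f] `<=` half_tree e.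
Proof.
move=> eE fE fT; have [l0 cf _ _ _] := fE.
apply: (connected_half_tree (x := epar f (elen f / 2))).
- exact: connected_epar.
- move=> _ [t /= + <-]; rewrite in_itv/= => tl.
  have [t0|t0] := leP t 0; first by apply/(vertex_off_seg eE)/(epar_out fE); left.
  have [lt|lt] := leP (elen f) t; first by apply/(vertex_off_seg eE)/(epar_out fE); right.
  by apply/half_tree_off/fT/seg_int_mem; rewrite t0.
- by exists (elen f / 2); rewrite //= in_itv/=; lra.
- exact/fT/(edge_mid fE).
Qed.

Lemma half_edgesP e f : oedges [set: X] V e ->
  half_edges e f <-> oedges [set: X] V f /\ seg_int f `<=` half_tree e.
Proof.
move=> eE; split.
  move=> [l0 cf cst [[Vs _] [Vt _]] [x [Tx nVTx] iso]].
  have nVx : ~ V x by move=> Vx; apply: nVTx.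
  rewrite half_tree_component// in iso; split.
    by split=> //; exists x.
  by rewrite /seg_int; case: iso => -> _; exact: component_half_tree.
move=> [fE fT]; have [l0 cf cst [Vs Vt] _] := fE.
have TK := closed_edge_half_tree eE fE fT.
have Tm := fT _ (edge_mid fE); have [_ nVm] := seg_int_sub fE (edge_mid fE).
split=> //.
  split; split=> //; apply: TK; [exists 0|exists (elen f)] => //;
  by rewrite /= in_itv/= lexx ltW.
exists (epar f (elen f / 2)); first by split=> // -[].
rewrite half_tree_component// -(seg_int_component fE (edge_mid fE)).
exact: seg_int_iso fE.
Qed.

Lemma half_edges_bar e f : half_edges e f -> half_edges e (bar f).
Proof. exact: oedges_bar. Qed.

Lemma half_edges_oedges e f : oedges [set: X] V e -> half_edges e f -> oedges [set: X] V f.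
Proof. by move=> eE /(half_edgesP _ eE)[]. Qed.

Lemma half_edges_tgt e f : oedges [set: X] V e -> half_edges e f -> half_tree e (tgt f).
Proof. by move=> eE [_ _ _ [_ []]]. Qed.

Lemma half_edges_src e f : oedges [set: X] V e -> half_edges e f -> half_tree e (src f).
Proof. by move=> eE [_ _ _ [[_ ?] _]]. Qed.

Lemma half_edges_self e : oedges [set: X] V e -> ~ half_edges e e /\ ~ half_edges e (bar e).
Proof.
move=> eE; have H f : seg_int f = seg_int e -> ~ half_edges e f.
  move=> ef /(half_edgesP _ eE)[_]; rewrite ef => /(_ _ (edge_mid eE)).
  by move=> /half_tree_off; apply; exact: edge_mid eE.
by split; apply: H => //; exact: seg_int_bar.
Qed.

(** The midpoint of [f] decides: an edge is connected, and it meets [seg_int e] only if it coincides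
    with it. *)
Lemma edge_cases e f : oedges [set: X] V e -> oedges [set: X] V f ->
  [\/ f = e, f = bar e, half_edges e f | half_edges (bar e) f].
Proof.
move=> eE fE; have beE := oedges_bar eE; pose m := epar f (elen f / 2).
have [em|nem] := pselect (seg_int e m).
  have := seg_int_unique fE eE (seg_int_eq fE eE (edge_mid fE) em).
  by case; [exact: Or41|exact: Or42].
have fY : seg_int f `<=` ~` seg_int e.
  by move=> z fz ez; apply: nem; rewrite -(seg_int_eq fE eE fz ez); exact: edge_mid fE.
have cf := edge_connected fE.
case: (half_tree_cover X_graph V_vertex eE nem) => Tm.
  apply: Or43; apply/(half_edgesP _ eE); split=> //.
  exact: (connected_half_tree cf fY (edge_mid fE) Tm).
apply: Or44; apply/(half_edgesP _ beE); split=> //.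
by apply: (connected_half_tree cf _ (edge_mid fE) Tm); rewrite seg_int_bar.
Qed.

Section Separated.
Hypothesis X_sc : simply_connected (R := R) X.

Lemma half_edges_disjoint e f : oedges [set: X] V e ->
  half_edges e f -> half_edges (bar e) f -> False.
Proof.
move=> eE Tf Uf; have beE := oedges_bar eE.
apply: (half_tree_disjoint X_graph V_vertex eE X_sc).
  exact: half_edges_tgt eE Tf.
exact: half_edges_tgt beE Uf.
Qed.

Lemma src_half_tree e : oedges [set: X] V e -> ~ half_tree e (src e).
Proof.
move=> eE Ts; have beE := oedges_bar eE.
apply: (half_tree_disjoint X_graph V_vertex eE X_sc Ts).
by rewrite -tgt_bar; exact: (tgt_half_tree beE).
Qed.

(** Built from the orientations that come with two given flows, so that their energies add up as
    they stand. *)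
Definition glued_orientation e O1 O2 := [set e] `|` (O1 `|` O2).

Section Glue.
Variables (e : oseg R X) (O1 O2 : set (oseg R X)).
Hypothesis eE : oedges [set: X] V e.
Hypothesis O1_or : orientation (half_edges e) O1.
Hypothesis O2_or : orientation (half_edges (bar e)) O2.
Let O := glued_orientation e O1 O2.
Let beE : oedges [set: X] V (bar e) := oedges_bar eE.
Let O1E f : O1 f -> half_edges e f. Proof. by case: O1_or => + _; exact. Qed.
Let O2E f : O2 f -> half_edges (bar e) f. Proof. by case: O2_or => + _; exact. Qed.
Let nTe := half_edges_self eE.
Let nUe : ~ half_edges (bar e) (bar e) /\ ~ half_edges (bar e) e.
Proof. by have := half_edges_self beE; rewrite barK. Qed.

Lemma glued_pos f : O f -> 0 < elen f.
Proof.
by case=> [->|[/O1E|/O2E]]; [case: eE|move=> []|move=> []].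
Qed.

Lemma glued_bar : ~ O (bar e).
Proof.
by case=> [|[/O1E|/O2E]]; [exact: bar_neq eE|apply nTe|apply nUe].
Qed.

Lemma glued_orientationP : orientation (oedges [set: X] V) O.
Proof.
split.
  by move=> f [->//|[/O1E|/O2E]]; exact: half_edges_oedges.
move=> f fE; case: (edge_cases eE fE) => [->|->|Tf|Uf].
- by left; split; [left|exact: glued_bar].
- by rewrite barK; right; split; [exact: glued_bar|left].
- have Tbf := half_edges_bar Tf.
  have nO g : half_edges e g -> ~ O1 g -> ~ O g.
    move=> Tg nO1 [ge|[//|/O2E]]; last exact: half_edges_disjoint eE Tg.
    by case: nTe => nT _; apply: nT; rewrite -[X in half_edges _ X]ge.
  have [_ /(_ f Tf)] := O1_or; case=> -[H1 H2]; [left|right].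
    by split; [right; left|exact: nO].
  by split; [exact: nO|right; left].
- have Ubf := half_edges_bar Uf.
  have nO g : half_edges (bar e) g -> ~ O2 g -> ~ O g.
    move=> Ug nO2 [ge|[/O1E Tg|//]]; last exact: half_edges_disjoint eE Tg Ug.
    by case: nUe => _ nU; apply: nU; rewrite -[X in half_edges _ X]ge.
  have [_ /(_ f Uf)] := O2_or; case=> -[H1 H2]; [left|right].
    by split; [right; right|exact: nO].
  by split; [exact: nO|right; right].
Qed.

Lemma sqnorm_glued w :
  (sqnorm O w = (rate w e ^+ 2 * elen e)%:E + (sqnorm O1 w + sqnorm O2 w))%E.
Proof.
have pos1 f : O1 f -> 0 < elen f by move=> O1f; apply: glued_pos; right; left.
have pos2 f : O2 f -> 0 < elen f by move=> O2f; apply: glued_pos; right; right.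
have nn f : O f -> 0 <= rate w f ^+ 2 * elen f.
  by move=> /glued_pos/ltW lf; rewrite mulr_ge0 ?sqr_ge0.
rewrite !sqnormE//; last exact: glued_pos.
rewrite esum_disjointU; last 2 first.
- by move=> _ -> [/O1E|/O2E]; [apply nTe|apply nUe].
- by move=> f Of; apply: nn; case: Of; [left|right].
rewrite esum_set1 ?lee_fin; last by apply: nn; left.
rewrite esum_disjointU//.
- by move=> f /O1E Tf /O2E; exact: half_edges_disjoint eE Tf.
- by move=> f Of; apply: nn; right.
Qed.

(** Besides the edges of its own half tree, [v] meets only [e], and only as incoming edge at
    [tgt e], because [src e] lies in the other half tree. *)
Lemma dstar_glued1 w v : (V `&` half_tree e) v ->
  dstar O w v = (v == tgt e)%:R * rate w e + dstar O1 w v.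
Proof.
move=> [Vv Tv]; rewrite /dstar.
have nO2 f : O2 f -> tgt f <> v /\ src f <> v.
  move=> /O2E Uf; split=> fv;
  apply: (half_tree_disjoint X_graph V_vertex eE X_sc Tv); rewrite -fv.
    exact: half_edges_tgt beE Uf.
  exact: half_edges_src beE Uf.
have -> : O `&` [set f | src f = v] = O1 `&` [set f | src f = v].
  apply/seteqP; split=> f [ Of fv]; split=> //; last by right; left.
  case: Of => [fe|[//|/nO2[_ //]]].
  by exfalso; apply: (src_half_tree eE); rewrite -[X in src X]fe fv.
rewrite addrA; congr (_ - _).
have fin1 : finite_set (O1 `&` [set f | tgt f = v]).
  apply: sub_finite_set (finite_edges_tgt X_graph V_vertex Vv).
  by move=> f [/O1E Tf fv]; split=> //; exact: half_edges_oedges Tf.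
have [vt|vt] := eqVneq v (tgt e).
  have -> : O `&` [set f | tgt f = v] = [set e] `|` (O1 `&` [set f | tgt f = v]).
    apply/seteqP; split=> f.
      by move=> [[->|[ O1f|/nO2[nfv _]]] fv]; [left|right|case: (nfv fv)].
    by move=> [->|[ O1f fv]]; split=> //; [left|right; left].
  rewrite fsbigU0//; last by move=> f [-> [/O1E Te _]]; case: nTe => /(_ Te).
  by rewrite fsbig_set1 mul1r.
rewrite mul0r add0r; apply: eq_fsbigl.
apply/seteqP; split=> f [ Of fv]; split=> //; last by right; left.
case: Of => [fe|[//|/nO2[nfv _]]]; last by case: (nfv fv).
by move/eqP: vt; rewrite -fv fe.
Qed.

Lemma dstar_glued2 w v : (V `&` half_tree (bar e)) v ->
  dstar O w v = dstar O2 w v - (v == src e)%:R * rate w e.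
Proof.
move=> [Vv Uv]; rewrite /dstar.
have nO1 f : O1 f -> tgt f <> v /\ src f <> v.
  move=> /O1E Tf; split=> fv;
  apply: (half_tree_disjoint X_graph V_vertex eE X_sc _ Uv); rewrite -fv.
    exact: half_edges_tgt eE Tf.
  exact: half_edges_src eE Tf.
have -> : O `&` [set f | tgt f = v] = O2 `&` [set f | tgt f = v].
  apply/seteqP; split=> f [ Of fv]; split=> //; last by right; right.
  case: Of => [fe|[/nO1[nfv _]|//]]; last by case: (nfv fv).
  exfalso; apply: (half_tree_disjoint X_graph V_vertex eE X_sc _ Uv).
  by rewrite -fv fe; exact: (tgt_half_tree eE).
rewrite -addrA -opprD; congr (_ - _).
have fin2 : finite_set (O2 `&` [set f | src f = v]).
  apply: sub_finite_set (finite_edges_src X_graph V_vertex Vv).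
  by move=> f [/O2E Uf fv]; split=> //; exact: half_edges_oedges Uf.
have [vt|vt] := eqVneq v (src e).
  have -> : O `&` [set f | src f = v] = [set e] `|` (O2 `&` [set f | src f = v]).
    apply/seteqP; split=> f.
      by move=> [[->|[/nO1[_ nfv]|O2f]] fv]; [left|case: (nfv fv)|right].
    by move=> [->|[ O2f fv]]; split=> //; [left|right; right].
  rewrite fsbigU0//; last by move=> f [-> [/O2E Ue _]]; case: nUe => _ /(_ Ue).
  by rewrite fsbig_set1 mul1r addrC.
rewrite mul0r addr0; apply: eq_fsbigl.
apply/seteqP; split=> f [ Of fv]; split=> //; last by right; right.
case: Of => [fe|[/nO1[_ nfv]|//]]; last by case: (nfv fv).
by move/eqP: vt; rewrite -fv fe.
Qed.

End Glue.
End Separated.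
End HalfTreeEdges.

(** * Resistances *)

Section Scaling.
Context {R : realType} {X : metricType R}.
Implicit Types (O : set (oseg R X)) (w : oseg R X -> R).

Lemma dstar_scale O w w' k v :
  finite_set (O `&` [set f | tgt f = v]) -> finite_set (O `&` [set f | src f = v]) ->
  (forall f, O f -> w' f = k * w f) -> dstar O w' v = k * dstar O w v.
Proof.
move=> fint fins ww'; rewrite /dstar mulrBr.
have H D : finite_set (O `&` D) ->
    \sum_(f \in O `&` D) rate w' f = k * \sum_(f \in O `&` D) rate w f.
  move=> fD; rewrite !fsbig_finite//= big_distrr/=.
  apply: eq_big_seq => f; rewrite in_fset_set// inE => -[Of _].
  by rewrite /rate ww'// mulrA.
by rewrite !H.
Qed.

Lemma sqnorm_scale O w w' k : k != 0 -> (forall f, O f -> 0 < elen f) ->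
  (forall f, O f -> w' f = k * w f) -> sqnorm O w' = ((k ^+ 2)%:E * sqnorm O w)%E.
Proof.
move=> k0 O0 ww'; rewrite !sqnormE// -esumZ.
- by apply: eq_esum => f Of; rewrite /rate ww'// !exprMn !mulrA.
- by rewrite exprn_even_gt0.
- by move=> f /O0/ltW lf; rewrite mulr_ge0 ?sqr_ge0.
Qed.

End Scaling.

Section Resistance.
Context {R : realType} {X : metricType R} (V : set X).
Hypothesis X_graph : metric_graph [set: X].
Hypothesis V_vertex : vertex_set [set: X] V.
Hypothesis X_sc : simply_connected (R := R) X.
Implicit Types (e f : oseg R X) (O : set (oseg R X)) (w : oseg R X -> R).

Definition unit_flow e O w : Prop :=
  [/\ orientation (half_edges V e) O, L2form (half_edges V e) O w &
      dstar_dirac (V `&` half_tree e) O w (tgt e)].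

Definition flow_energies e : set (\bar R) :=
  [set r | exists O w, unit_flow e O w /\ r = sqnorm O w].

(* If [half_tree e] is not transient there is no unit flow, and the infimum of
   the empty set is [+oo]. *)
Lemma half_resistanceE e : oedges [set: X] V e ->
  half_resistance V e = ereal_inf (flow_energies e).
Proof.
move=> eE; rewrite /half_resistance; case: asboolP => [_|ntr].
  congr ereal_inf; apply/seteqP; split=> r.
    by move=> [ O [w [Oor wL wd rE]]]; exists O, w.
  by move=> [ O [w [[Oor wL wd] rE]]]; exists O, w.
rewrite [flow_energies e](_ : _ = set0) ?ereal_inf0//.
apply/seteqP; split=> // r [ O [w [[Oor wL wd] _]]]; apply: ntr.
exists (tgt e), (V `&` half_tree e), O, w; split=> //.
- exact: tgt_half_tree eE.
- split; first exact: half_tree_vertex_set.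
  by have [_ _ _ [_ Vt] _] := eE; split=> //; exact: tgt_half_tree eE.
Qed.

Lemma half_edges_pos e O f : orientation (half_edges V e) O -> O f -> 0 < elen f.
Proof. move=> [OE _] Of; by have [] := OE _ Of. Qed.

Lemma flow_energies_ge0 e r : flow_energies e r -> (0 <= r)%E.
Proof.
by move=> [ O [w [[Oor _ _] ->]]]; apply: sqnorm_ge0 => f; exact: half_edges_pos Oor.
Qed.

Section Edge.
Variables (e : oseg R X) (c : R).
Hypothesis eE : oedges [set: X] V e.
Hypothesis c_ge0 : 0 <= c.
(** One [c] for all orientations: flows with arbitrary orientations are compared with the same
    projection coefficient. *)
Hypothesis c_proj : forall O, orientation (oedges [set: X] V) O ->
  exists p, orth_proj [set: X] V O (dform e) p /\ rate p e = c.

Let beE : oedges [set: X] V (bar e) := oedges_bar eE.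
Let l0 : 0 < elen e. Proof. by case: eE. Qed.

Let fin_at O e' v : oedges [set: X] V e' -> orientation (half_edges V e') O -> V v ->
  finite_set (O `&` [set f | tgt f = v]) /\ finite_set (O `&` [set f | src f = v]).
Proof.
move=> e'E [ OE _] Vv; split.
  apply: sub_finite_set (finite_edges_tgt X_graph V_vertex Vv) => f [/OE Tf fv].
  by split=> //; exact: (half_edges_oedges e'E).
apply: sub_finite_set (finite_edges_src X_graph V_vertex Vv) => f [/OE Tf fv].
by split=> //; exact: (half_edges_oedges e'E).
Qed.

Lemma flow_bound O1 w1 O2 w2 : unit_flow e O1 w1 -> unit_flow (bar e) O2 w2 ->
  exists N1 N2, [/\ sqnorm O1 w1 = N1%:E, sqnorm O2 w2 = N2%:E &
    elen e <= c * (elen e + N1 + N2)].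
Proof.
move=> [or1 [co1 fin1] d1] [or2 [co2 fin2] d2].
have pos1 f : O1 f -> 0 < elen f by exact: half_edges_pos or1.
have pos2 f : O2 f -> 0 < elen f by exact: half_edges_pos or2.
have [N1 N1E] : exists N1, sqnorm O1 w1 = N1%:E.
  by exists (fine (sqnorm O1 w1)); rewrite fineK// ge0_fin_numE// sqnorm_ge0.
have [N2 N2E] : exists N2, sqnorm O2 w2 = N2%:E.
  by exists (fine (sqnorm O2 w2)); rewrite fineK// ge0_fin_numE// sqnorm_ge0.
exists N1, N2; split=> //.
pose O := glued_orientation e O1 O2.
have Oor : orientation (oedges [set: X] V) O by exact: glued_orientationP.
have [p [[ph porth] pc]] := c_proj Oor; have [[_ pfin] _] := ph.
have disj f := @half_edges_disjoint _ _ _ X_graph V_vertex X_sc e f eE.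
have [nTe nTbe] := half_edges_self eE.
have := half_edges_self beE; rewrite barK => -[nUbe nUe].
(* [dstar] is inflow minus outflow. As [e] brings 1 into [tgt e] and takes 1 out of [src e], the
   unit flow [w1] enters with a minus sign and [w2] with a plus sign. *)
pose w f := if `[< half_edges V e f >] then - w1 f
  else if `[< half_edges V (bar e) f >] then w2 f else dform e f.
have wT f : half_edges V e f -> w f = -1 * w1 f.
  by move=> Tf; rewrite /w asboolT// mulN1r.
have wU f : half_edges V (bar e) f -> w f = 1 * w2 f.
  move=> Uf; rewrite /w asboolF ?asboolT ?mul1r// => Tf; exact: disj Tf Uf.
have we : w e = elen e by rewrite /w !asboolF// /dform eqxx.
have wbe : w (bar e) = - elen e.
  rewrite /w !asboolF// /dform eqxx ifN//; apply/eqP; exact: bar_neq eE.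
have O1T f : O1 f -> half_edges V e f by case: or1 => + _; exact.
have O2U f : O2 f -> half_edges V (bar e) f by case: or2 => + _; exact.
have rwe : rate w e = 1 by rewrite /rate we divff// gt_eqF.
have wN : sqnorm O w = (elen e + N1 + N2)%:E.
  rewrite (sqnorm_glued X_graph V_vertex X_sc eE or1 or2) rwe expr1n mul1r.
  have -> : sqnorm O1 w = (((-1) ^+ 2)%:E * sqnorm O1 w1)%E.
    apply: sqnorm_scale => //.
    by move=> f O1f; apply/wT/O1T.
  have -> : sqnorm O2 w = ((1 ^+ 2)%:E * sqnorm O2 w2)%E.
    by apply: sqnorm_scale => //; move=> f O2f; apply/wU/O2U.
  by rewrite sqrrN !expr1n !mul1e N1E N2E -!EFinD addrA.
have wco : cochain (oedges [set: X] V) w.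
  move=> f fE; case: (edge_cases X_graph V_vertex eE fE) => [->|->|Tf|Uf].
  - by rewrite wbe we.
  - by rewrite barK wbe we opprK.
  - by rewrite !wT ?co1 ?mulN1r//; exact: half_edges_bar.
  - by rewrite !wU ?co2 ?mul1r//; exact: half_edges_bar.
have wh : harmonicL2 [set: X] V O w.
  split; first by split=> //; rewrite wN ltry.
  move=> v Vv.
  have [Tv|Uv] := half_tree_cover X_graph V_vertex eE (vertex_off_seg eE Vv).
    rewrite (dstar_glued1 X_graph V_vertex X_sc eE or1 or2)// rwe mulr1.
    have [ft fs] := fin_at eE or1 Vv.
    rewrite (dstar_scale (w := w1) (k := -1) ft fs) ?d1 ?mulN1r ?subrr//.
    by move=> f /O1T; exact: wT.
  rewrite (dstar_glued2 X_graph V_vertex X_sc eE or1 or2)// rwe mulr1.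
  have [ft fs] := fin_at beE or2 Vv.
  rewrite (dstar_scale (w := w2) (k := 1) ft fs).
    by rewrite d2// mul1r tgt_bar subrr.
  by move=> f /O2U; exact: wU.
have pe0 : 0 <= rate p e by rewrite pc.
rewrite -pc; exact: (projection_bound (glued_pos eE or1 or2) (or_introl erefl)
  (glued_bar eE or1 or2) pfin pe0 (porth _ ph) (porth _ wh) rwe wN).
Qed.

Lemma flow_attained : 0 < c -> exists O1 w1 O2 w2 N1 N2,
  [/\ unit_flow e O1 w1, unit_flow (bar e) O2 w2, sqnorm O1 w1 = N1%:E,
      sqnorm O2 w2 = N2%:E & c * (elen e + N1 + N2) = elen e].
Proof.
move=> c0; have [ O0 O0or] := orientation_exists [set: X] V.
have sub_or e' : oedges [set: X] V e' ->
    orientation (half_edges V e') (O0 `&` half_edges V e').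
  move=> e'E; split; first by move=> f [].
  move=> f Tf; have Tbf := half_edges_bar Tf.
  have fE := half_edges_oedges e'E Tf.
  case: O0or => _ /(_ f fE)[] [H1 H2]; [left|right].
    by split=> // -[].
  by split=> // -[].
have or1 := sub_or e eE; have or2 := sub_or (bar e) beE.
set O1 := O0 `&` half_edges V e in or1; set O2 := O0 `&` _ in or2.
pose O := glued_orientation e O1 O2.
have Oor : orientation (oedges [set: X] V) O by exact: glued_orientationP.
have [p [[ph porth] pc]] := c_proj Oor; have [[pco pfin] pd] := ph.
have pE : sqnorm O p = (c * elen e)%:E.
  rewrite -pc; apply: projection_energy => //.
  - exact: (glued_pos eE or1 or2).
  - by left.
  - exact: (glued_bar eE or1 or2).
  - by rewrite pc.
  - exact: porth.
have pos1 f : O1 f -> 0 < elen f by exact: half_edges_pos or1.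
have pos2 f : O2 f -> 0 < elen f by exact: half_edges_pos or2.
have := pE; rewrite (sqnorm_glued X_graph V_vertex X_sc eE or1 or2) pc.
have := sqnorm_ge0 p pos1; have := sqnorm_ge0 p pos2.
case E1 : (sqnorm O1 p) => [s1| |]//; case E2 : (sqnorm O2 p) => [s2| |]// _ _ sE0.
(* Divided by [c ^+ 2], this becomes the asserted [elen e + N1 + N2 = elen e / c]. *)
have sE : c ^+ 2 * elen e + (s1 + s2) = c * elen e by exact: EFin_inj sE0.
have ic0 : c^-1 != 0 by rewrite invr_eq0 gt_eqF.
have nic0 : - c^-1 != 0 by rewrite oppr_eq0.
have co_sub e' k : oedges [set: X] V e' -> cochain (half_edges V e') (fun f => k * p f).
  move=> e'E f Tf; rewrite pco ?mulrN//.
  exact: (half_edges_oedges e'E Tf).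
have N1E : sqnorm O1 (fun f => - c^-1 * p f) = (c^-1 ^+ 2 * s1)%:E.
  by rewrite (sqnorm_scale (w := p) (k := - c^-1))// sqrrN E1.
have N2E : sqnorm O2 (fun f => c^-1 * p f) = (c^-1 ^+ 2 * s2)%:E.
  by rewrite (sqnorm_scale (w := p) (k := c^-1))// E2.
(* Dividing by [c] normalises the flow through [e] to 1; the signs mirror those used to glue two
   flows. *)
exists O1, (fun f => - c^-1 * p f), O2, (fun f => c^-1 * p f).
exists (c^-1 ^+ 2 * s1), (c^-1 ^+ 2 * s2); split=> //.
- split=> //; first by split; [exact: co_sub|rewrite N1E ltry].
  move=> v Tv; have [Vv _] := Tv; have [ft fs] := fin_at eE or1 Vv.
  rewrite (dstar_scale (w := p) (k := - c^-1) ft fs)//.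
  have := pd v Vv; rewrite (dstar_glued1 X_graph V_vertex X_sc eE or1 or2)// pc.
  move=> /eqP; rewrite addrC addr_eq0 => /eqP ->.
  by rewrite mulNr mulrN opprK mulrC mulfK// gt_eqF.
- split=> //; first by split; [exact: co_sub|rewrite N2E ltry].
  move=> v Tv; have [Vv _] := Tv; have [ft fs] := fin_at beE or2 Vv.
  rewrite (dstar_scale (w := p) (k := c^-1) ft fs)//.
  have := pd v Vv; rewrite (dstar_glued2 X_graph V_vertex X_sc eE or1 or2)// pc.
  move=> /eqP; rewrite subr_eq0 => /eqP ->.
  by rewrite tgt_bar mulrC mulfK// gt_eqF.
have cn0 : c != 0 by rewrite gt_eqF.
apply: (mulfI cn0); rewrite -sE; field.
by rewrite gt_eqF.
Qed.

Lemma conductance_formula :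
  (c / elen e)%:E = (half_resistance V e + half_resistance V (bar e) + (elen e)%:E)^-1%E.
Proof.
rewrite !half_resistanceE//.
have R0 e' : (0 <= ereal_inf (flow_energies e'))%E.
  by apply: le_ereal_inf_tmp => r; exact: flow_energies_ge0.
have lower N1 N2 : flow_energies e N1 -> flow_energies (bar e) N2 ->
    exists n1 n2, [/\ N1 = n1%:E, N2 = n2%:E & elen e <= c * (elen e + n1 + n2)].
  move=> [ O1 [w1 [f1 ->]]] [ O2 [w2 [f2 ->]]]; exact: flow_bound.
have [c0|c0] := eqVneq c 0.
  (* With unit flows on both sides, [flow_bound] would give [elen e <= 0]. *)
  have [E1|E2] : flow_energies e = set0 \/ flow_energies (bar e) = set0.
    have [/eqP|/set0P[r1 r1E]] := boolP (flow_energies e == set0); first by left.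
    have [/eqP|/set0P[r2 r2E]] := boolP (flow_energies (bar e) == set0); first by right.
    have [n1 [n2 [_ _]]] := lower _ _ r1E r2E.
    by rewrite c0 mul0r leNgt l0.
  (* One infimum is [+oo] and [R0] keeps the other away from [-oo], which would absorb it; so the
     sum is [+oo] and its inverse 0. *)
  - rewrite E1 ereal_inf0 c0 mul0r.
    by have := R0 (bar e); case: (ereal_inf _).
  - rewrite E2 ereal_inf0 c0 mul0r.
    by have := R0 e; case: (ereal_inf _).
have cp : 0 < c by rewrite lt_neqAle eq_sym c0.
have [ O1 [w1 [ O2 [w2 [N1 [N2 [f1 f2 N1E N2E cN]]]]]]] := flow_attained cp.
have F1 : flow_energies e N1%:E by exists O1, w1.
have F2 : flow_energies (bar e) N2%:E by exists O2, w2.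
have lb1 : (ereal_inf (flow_energies e) <= N1%:E)%E by exact: ereal_inf_lbound.
have lb2 : (ereal_inf (flow_energies (bar e)) <= N2%:E)%E by exact: ereal_inf_lbound.
(* Only the sum of the energies is bounded below. Varying one flow while the other stays at its
   optimum separates the two infima. *)
have sum_n n1 n2 : elen e <= c * (elen e + n1 + n2) -> N1 + N2 <= n1 + n2.
  by move=> H; rewrite -(ler_pM2l cp); lra.
have low1 : (N1%:E <= ereal_inf (flow_energies e))%E.
  apply: le_ereal_inf_tmp => r rE; have [n1 [n2 [-> nE H]]] := lower _ _ rE F2.
  by rewrite lee_fin; have := EFin_inj nE; have := sum_n _ _ H; lra.
have low2 : (N2%:E <= ereal_inf (flow_energies (bar e)))%E.
  apply: le_ereal_inf_tmp => r rE; have [n1 [n2 [nE -> H]]] := lower _ _ F1 rE.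
  by rewrite lee_fin; have := EFin_inj nE; have := sum_n _ _ H; lra.
have -> : ereal_inf (flow_energies e) = N1%:E by apply/le_anti; rewrite lb1 low1.
have -> : ereal_inf (flow_energies (bar e)) = N2%:E by apply/le_anti; rewrite lb2 low2.
have le0 : elen e != 0 by rewrite gt_eqF.
have s0 : elen e + N1 + N2 != 0.
  by apply/eqP => s0; move: le0; rewrite -{1}cN s0 mulr0 eqxx.
rewrite -!EFinD (_ : N1 + N2 + elen e = elen e + N1 + N2); last by ring.
rewrite inver (negbTE s0); congr EFin.
by rewrite -{1}cN invfM mulrA divff ?mul1r.
Qed.

End Edge.
End Resistance.

Theorem theorem7p11 (R : realType) (X X' : pmetricType R) (phi : X' -> X)
    (g : nat) (V : set X)
    (mu' : {measure set (borel X') -> \bar R})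
    (mu : {measure set (borel X) -> \bar R})
    (Res : oseg R X -> \bar R)
    (hX : metric_graph [set: X]) (cX : compact [set: X])
    (hg : has_genus [set: X] g) (g2 : (2 <= g)%N)
    (hphi : universal_covering phi)
    (hV : vertex_set [set: X] V)
    (hmu' : canonical_measure mu')
    (hmu : pushdown_measure phi V mu' mu)
    (hRes : is_resistance phi V Res)
    (e : oseg R X) (he : oedges [set: X] V e) :
  let S := (Res e + Res (bar e))%E in
  restr_edge mu e (S + (elen e)%:E)^-1%E.
Proof.
move=> S; have l0 : 0 < elen e by case: he.
have [e' e'_lift] := oedge_lift_exists hphi hX hV he.
have [e'E e'l _] := e'_lift.
have [[X'_graph X'_sc] _ _ _ _] := hphi.
have V'_vertex := covering_vertex_set hphi hX cX hV.
have [_ /(_ e he)[[k k0 mu_e] mu_lift]] := hmu.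
(* The density [k] of [mu] on [e], tested on the whole space, gives the mass of [e], which is also
   the mass of its lift. *)
have mu_e' : mu' (seg_int e') = (k * elen e)%:E.
  rewrite -mu_lift//; have := mu_e setT measurableT.
  rewrite setTI => ->; rewrite /edge_dx preimage_setT setTI lebesgue_measure_itv/=.
  by rewrite lte_fin l0 sube0 EFinM.
(* The same mass is the projection coefficient of [e'] for every orientation. With [c = k * elen e],
   the quotient [c / elen e] in [conductance_formula] is the density [k] itself. *)
have proj O : orientation (oedges [set: X'] (phi @^-1` V)) O ->
    exists p, orth_proj [set: X'] (phi @^-1` V) O (dform e') p /\ rate p e' = k * elen e.
  move=> Oor; have [_ /(_ e' e'E)[_ [p [pp mup]]]] := hmu' _ _ V'_vertex Oor.
  by exists p; split=> //; apply: EFin_inj; rewrite -mu_e' -mup.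
have := conductance_formula X'_graph V'_vertex X'_sc e'E (mulr_ge0 k0 (ltW l0)) proj.
rewrite e'l mulfK ?gt_eqF// -(hRes e e' he e'_lift).
rewrite -(hRes (bar e) (bar e') (oedges_bar he) (lift_of_bar e'_lift)) => kE.
by rewrite /S -kE.
Qed.
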